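(* Fix $\delta\in(0,1/2)$ and $0<\alpha_0<\alpha_1$. Let $p,n\in\mathbb{N}$ and set $$\tau_{\text{dense}}^2(p,s,n,\alpha):=s\left(\frac{ns}{\sqrt{p\log\log(np)}}\right)^{-\frac{4\alpha}{4\alpha+1}},\qquad \mathcal{V}_{\text{test}}:=\left\{1,2,4,8,\dots,2^{\left\lceil\log_2\left(\left(\frac{np}{\sqrt{p\log\log(np)}}\right)^{\frac{2}{4\alpha_0+1}}\right)\right\rceil}\right\}.$$ If $\eta\in(0,1)$, then there exist constants $K_\eta>0$ and $C_\eta>0$ depending only on $\eta$ such that for all $C>C_\eta$ we have $$P_0\left\{\max_{\nu\in\mathcal{V}_{\text{test}}}\varphi_\nu=1\right\}+\max_{p^{1/2+\delta}\le s\le p}\ \sup_{\alpha\in[\alpha_0,\alpha_1]}\ \sup_{\substack{f\in\mathcal{F}(s,\alpha),\\ \|f\|_2\ge C\tau_{\text{dense}}(p,s,n,\alpha)}}P_f\left\{\max_{\nu\in\mathcal{V}_{\text{test}}}\varphi_\nu=0\right\}\le\eta,$$ where $$\varphi_\nu=\mathbbm{1}_{\left\{n\sum_{j=1}^p\sum_{k\le\nu}X_{k,j}^2\ge\nu p+K_\eta\left(\sqrt{\nu p\log\log(np)}+\log\log(np)\right)\right\}}.$$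
   Context: Model: one observes the $p$-dimensional Gaussian white noise model $dY_x = f(x)\,dx + \frac{1}{\sqrt n}\,dB_x$, $x\in[0,1]^p$. $P_f$ denotes the law of the observation when the signal is $f$, and $P_0$ the law when $f\equiv 0$. $\|\cdot\|_2$ is the $L^2([0,1]^p)$ norm. $s$ ranges over integers in $[p]=\{1,\dots,p\}$. Parameter space: $\{\psi_k\}_{k\ge1}\subset L^2([0,1])$ is a fixed (known) orthonormal system of functions orthogonal to constants, which does not depend on $\alpha\in[\alpha_0,\alpha_1]$. For $\alpha>0$ and $s\in[p]$, $$\mathscr{T}(s,\alpha):=\left\{\Theta=(\theta_{k,j})\in\mathbb{R}^{\mathbb{N}\times p}:\ \sum_{j=1}^p\mathbbm{1}_{\{\Theta_j\ne0\}}\le s,\ \ \sum_{k=1}^\infty\frac{\theta_{k,j}^2}{k^{-2\alpha}}\le1\text{ for all }j\right\},$$ where $\Theta_j$ is the $j$th column of $\Theta$, and $\mathcal{F}(s,\alpha)$ is the corresponding set of functions $f(x)=\sum_{j=1}^p\sum_{k\ge1}\theta_{k,j}\psi_k(x_j)$ with $\Theta\in\mathscr{T}(s,\alpha)$. Thus $\|f\|_2^2=\sum_{j}\sum_k\theta_{k,j}^2$. Data in sequence space: $X_{k,j}:=\int_{[0,1]^p}\psi_k(x_j)\,dY_x$; under $P_f$ these are independent with $X_{k,j}\sim N(\theta_{k,j},n^{-1})$. Convention: iterated logarithms such as $\log\log(np)$ are understood to be equal to a universal constant whenever the expression would otherwise be less than one.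
   Formalization: The constant C_η is allowed to depend on the fixed α_1 as well as on η (uniformity over all α_1 is false, e.g. p=s=1 with α_0 huge and log log n large); K_η depends only on η, and both may depend on the universal constant of the log log convention. *)

(* Defs.v *)
From HB Require Import structures.
From mathcomp Require Import all_boot all_order all_algebra.
From mathcomp Require Import all_classical all_reals all_analysis.

Set Implicit Arguments.
Unset Strict Implicit.
Unset Printing Implicit Defensive.

Import Order.TTheory GRing.Theory Num.Theory.
Import numFieldNormedType.Exports.

Local Open Scope classical_set_scope.
Local Open Scope ring_scope.

Section lebesgue_cube.
Context {R : realType}.

(* Lebesgue measure on [0,1] (the uniform density is 1 on [0,1], 0 outside).
   Functions on [0,1] and [0,1]^p are represented by Borel functions on R and
   R^p, of which only the values on the cube matter. *)
Definition unit_leb : probability (measurableTypeR R) R :=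
  uniform_prob (@ltr01 R).

Definition cons_tuple p (z : measurableTypeR R * p.-tuple (measurableTypeR R)) :
  p.+1.-tuple (measurableTypeR R) := [the p.+1.-tuple _ of z.1 :: z.2].

Lemma measurable_cons_tuple p : measurable_fun setT (@cons_tuple p).
Proof. by apply: measurable_cons. Qed.

HB.instance Definition _ p :=
  isMeasurableFun.Build _ _ _ _ (@cons_tuple p) (@measurable_cons_tuple p).

Fixpoint cube_leb p : probability (p.-tuple (measurableTypeR R)) R :=
  match p with
  | 0%N => \d_([tuple] : 0.-tuple (measurableTypeR R))
  | q.+1 => distribution (unit_leb \x cube_leb q)%E (@cons_tuple q)
  end.

End lebesgue_cube.

Notation cube R p := (p.-tuple (measurableTypeR R)).

Section white_noise_model.
Context {R : realType}.

(* Gaussian law with mean m and variance v, including the degenerate case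
   v = 0, where the library's normal_prob is not a point mass. *)
Definition gaussian_law (m v : R) : set (measurableTypeR R) -> \bar R :=
  if v == 0 then \d_m else normal_prob m (Num.sqrt v).

(* dY_x = f(x) dx + n^{-1/2} dB_x on [0,1]^p.  The observation is the process
   Y g = \int g dY indexed by L^2([0,1]^p), and P f is its law when the signal
   is f: Y is then a Gaussian process with mean <f, g> and covariance
   <g, h> / n.  Being a Gaussian process means that every finite linear
   combination is Gaussian. *)
Definition gaussian_white_noise (p n : nat) d (T : measurableType d)
    (Y : (cube R p -> R) -> {mfun T >-> measurableTypeR R})
    (P : (cube R p -> R) -> probability T R) :=
  forall f, f \in Lfun (cube_leb p) 2%:E ->
  forall m (a : 'I_m -> R) (g : 'I_m -> cube R p -> R),
    (forall i, g i \in Lfun (cube_leb p) 2%:E) ->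
  forall A : set (measurableTypeR R), measurable A ->
    P f [set w | A (\sum_(i < m) a i * Y (g i) w)] =
    gaussian_law (\int[cube_leb p]_x (f x * \sum_(i < m) a i * g i x))
      ((\int[cube_leb p]_x (\sum_(i < m) a i * g i x) ^+ 2) / n%:R) A.

(* Basis functions and coefficients are indexed by k >= 1; values at k = 0 are
   irrelevant. *)
Definition orthonormal_centered (psi : nat -> measurableTypeR R -> R) :=
  [/\ forall k, (0 < k)%N -> psi k \in Lfun unit_leb 2%:E,
      forall k l, (0 < k)%N -> (0 < l)%N ->
        \int[unit_leb]_x (psi k x * psi l x) = (k == l)%:R
    & forall k, (0 < k)%N -> \int[unit_leb]_x psi k x = 0].

Definition basis_fun p (psi : nat -> measurableTypeR R -> R) k (j : 'I_p)
  : cube R p -> R := fun x => psi k (tnth x j).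

Definition coef_space p (s : nat) (alpha : R) : set (nat -> 'I_p -> R) :=
  [set theta : nat -> 'I_p -> R |
    (#|[set j | `[< exists2 k, (0 < k)%N & (theta k j != 0)%R >]]%SET| <= s)%N /\
    forall j, (\sum_(1 <= k <oo)
      (theta k j ^+ 2 / k%:R `^ (- (2 * alpha)))%:E <= 1)%E].

(* The series defining f converges in L^2([0,1]^p). *)
Definition signal_space p (psi : nat -> measurableTypeR R -> R) (s : nat)
    (alpha : R) : set (cube R p -> R) :=
  [set f | f \in Lfun (cube_leb p) 2%:E /\
    exists2 theta, coef_space s alpha theta &
      (fun N => 'N[cube_leb p]_2%:E[EFin \o (fun x => f x -
          \sum_(j < p) \sum_(1 <= k < N.+1) theta k j * basis_fun psi k j x)%R]%E)
      @ \oo --> 0%E].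

(* log log x, replaced by the constant c whenever it is less than one (which,
   with the library's convention ln x = 0 for x <= 0, includes every x for
   which log log x is undefined). *)
Definition loglog (c x : R) : R := if ln (ln x) < 1 then c else ln (ln x).

Definition tau_dense_sq (c : R) (p s n : nat) (alpha : R) : R :=
  s%:R * (n%:R * s%:R / Num.sqrt (p%:R * loglog c (n * p)%:R))
           `^ (- (4 * alpha / (4 * alpha + 1))).

Definition tau_dense (c : R) (p s n : nat) (alpha : R) : R :=
  Num.sqrt (tau_dense_sq c p s n alpha).

(* The exponent of the largest element.  It is truncated below at 0, so that
   1 is always in V_test; this is immaterial unless c > n^2 p. *)
Definition V_test_exponent (c : R) (p n : nat) (alpha0 : R) : nat :=
  absz (Num.max 0 (Num.ceil
      (ln ((n%:R * p%:R / Num.sqrt (p%:R * loglog c (n * p)%:R))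
             `^ (2 / (4 * alpha0 + 1))) / ln 2))).

Definition V_test (c : R) (p n : nat) (alpha0 : R) : seq nat :=
  [seq (2 ^ i)%N | i <- iota 0 (V_test_exponent c p n alpha0).+1].

Section test.
Context (p n : nat) {d} {T : measurableType d}.
Variables (psi : nat -> measurableTypeR R -> R).
Variables (Y : (cube R p -> R) -> {mfun T >-> measurableTypeR R}).

Definition X_coef k (j : 'I_p) : T -> R := Y (basis_fun psi k j).

Definition phi (c K : R) (nu : nat) (w : T) : bool :=
  nu%:R * p%:R +
    K * (Num.sqrt (nu%:R * p%:R * loglog c (n * p)%:R) + loglog c (n * p)%:R)
  <= n%:R * \sum_(j < p) \sum_(1 <= k < nu.+1) X_coef k j w ^+ 2.

Definition max_phi (c K alpha0 : R) (w : T) : nat :=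
  \max_(nu <- V_test c p n alpha0) phi c K nu w.

End test.

End white_noise_model.

(* Main.v *)
Require Import Defs.
From HB Require Import structures.
From mathcomp Require Import all_boot all_order all_algebra.
From mathcomp Require Import all_classical all_reals all_analysis.
From mathcomp Require Import measurable_realfun.
From mathcomp Require Import lra.

Set Implicit Arguments.
Unset Strict Implicit.
Unset Printing Implicit Defensive.

Import Order.TTheory GRing.Theory Num.Theory.
Import numFieldNormedType.Exports.

Local Open Scope classical_set_scope.
Local Open Scope ring_scope.

(** The statistic n * sum of the X_(k,j)^2 over k <= nu is the squared length of
    a Gaussian vector with d = nu p independent coordinates of variance 1 and
    mean sqrt n theta_(k,j).  It concentrates around d + n E, where E is the sum
    of the theta_(k,j)^2 with k <= nu, with fluctuations of order sqrt (d + n E).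
    Write L for log log (n p).

    Under the null hypothesis each test rejects with probability at most
    exp (- (K - 1) L / 4) ([chi2_upper_tail]), and the grid has at most a
    constant times exp L levels ([V_test_exponent_le]), so a large K makes the
    sum of these probabilities small ([type_I_error]).

    For an alternative f of smoothness alpha and sparsity s, put
    b = n s / sqrt (p L) and nu0 = b^(2 / (4 alpha + 1)).  If b < 1, the
    separation C tau is larger than the norm of every signal
    ([no_separated_signal]).  Otherwise the grid contains some nu between nu0
    and 2 nu0 ([V_test_dyadic]).  The energy of f beyond level nu is at most
    s nu0^(- 2 alpha) = tau^2, and n tau^2 = sqrt (p L nu0): the energy up to
    level nu is therefore at least (C - 1) tau^2, which exceeds the threshold
    of the test at nu by a multiple of the standard deviation.  The term K L of
    the threshold is dominated by sqrt (d L) because L is at most a constant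
    times p nu0; this is where s >= sqrt p is used and where alpha1 enters
    ([loglog_le_dimension]).  The lower tail bound
    [noncentral_chi2_lower_tail] then concludes ([type_II_error]).

    The model gives the law of every linear combination of the observations,
    and the argument never passes through their joint law.  Since
    exp (l x^2) is the average of exp (sqrt (2 l) g x) over a standard normal g,
    the exponential moment of a sum of squares is an average of exponential
    moments of linear combinations, and has the closed form
    [integral_expR_sum_sqr].  Both tails follow from that formula: the upper one
    by the Chernoff bound, the lower one by comparing the first two moments of
    exp (l * the sum of squares). *)

(** * Gaussian integrals *)

(** The density is a version of the Radon-Nikodym derivative, for which the
    change of measure is known. *)
Lemma ge0_integral_normal_prob (R : realType) (m s : R) (f : _ -> \bar R) :
  measurable_fun setT f -> (forall x, (0 <= f x)%E) ->
  (\int[normal_prob m s]_x f x =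
   \int[lebesgue_measure]_x (f x * (normal_pdf m s x)%:E))%E.
Proof.
move=> mf f0.
have dom := @normal_prob_dominates R m s.
rewrite -(Radon_Nikodym_SigmaFinite.change_of_variables dom)//.
apply: ae_eq_integral => //.
- apply: emeasurable_funM => //.
  exact: measurable_int (Radon_Nikodym_SigmaFinite.f_integrable _).
- apply: emeasurable_funM => //.
  by apply/measurable_EFinP; exact: measurable_normal_pdf.
- apply: ae_eqe_mul2l; apply: integral_ae_eq => //.
  + exact: Radon_Nikodym_SigmaFinite.f_integrable.
  + by apply/measurable_EFinP; exact: measurable_normal_pdf.
  + by move=> A _ mA; rewrite -Radon_Nikodym_SigmaFinite.f_integral.
Qed.

(** Completing the square: tilting by exp (t x) turns N(m, s^2) into
    N(m + t s^2, s^2), up to the constant on the right-hand side. *)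
Lemma integral_expR_normal_pdf (R : realType) (t m s : R) : s != 0 ->
  (\int[lebesgue_measure]_x ((expR (t * x))%:E * (normal_pdf m s x)%:E) =
   (expR (t * m + t ^+ 2 * s ^+ 2 / 2))%:E)%E.
Proof.
move=> s0.
transitivity (\int[lebesgue_measure]_x ((expR (t * m + t ^+ 2 * s ^+ 2 / 2))%:E *
   (normal_pdf (m + t * s ^+ 2) s x)%:E))%E.
  apply: eq_integral => x _; rewrite -!EFinM; congr (_%:E).
  rewrite !normal_pdfE// mulrCA [RHS]mulrCA /normal_fun -!expRD.
  have u0 : s ^+ 2 *+ 2 != 0 by rewrite mulrn_eq0/= sqrf_eq0.
  congr (_ * expR _); apply: (mulIf u0); rewrite 2!mulrDl !divfK//; lra.
rewrite ge0_integralZl//.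
- by rewrite integral_normal_pdf mule1.
- by apply/measurable_EFinP; exact: measurable_normal_pdf.
- by move=> x _; rewrite lee_fin normal_pdf_ge0.
Qed.

(** Here the tilted law is N(b s^2, s^2) with s^2 = 1 / (1 - 2 k). *)
Lemma integral_expR_quadratic_normal_pdf (R : realType) (b k : R) : k < 1 / 2 ->
  (\int[lebesgue_measure]_x
     ((expR (b * x + k * x ^+ 2))%:E * (normal_pdf 0 1 x)%:E) =
   ((Num.sqrt (1 - 2 * k))^-1 * expR (b ^+ 2 / (2 * (1 - 2 * k))))%:E)%E.
Proof.
move=> k2.
have u0 : 0 < 1 - 2 * k by lra.
set s := (Num.sqrt (1 - 2 * k))^-1.
have sq0 : 0 < Num.sqrt (1 - 2 * k) by rewrite sqrtr_gt0.
have s0 : 0 < s by rewrite invr_gt0.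
have s2 : s ^+ 2 = (1 - 2 * k)^-1 by rewrite exprVn sqr_sqrtr// ltW.
transitivity (\int[lebesgue_measure]_x ((s * expR (b ^+ 2 / (2 * (1 - 2 * k))))%:E *
   (normal_pdf (b * s ^+ 2) s x)%:E))%E.
  apply: eq_integral => x _; rewrite -!EFinM; congr (_%:E).
  rewrite !normal_pdfE ?gt_eqF//.
  have -> : normal_peak s = s^-1 * normal_peak 1.
    rewrite /normal_peak expr1n mul1r -mulrnAr sqrtrM ?sqr_ge0// sqrtr_sqr.
    by rewrite gtr0_norm// invfM.
  rewrite mulrCA [RHS](_ : _ = normal_peak 1 * (expR (b ^+ 2 / (2 * (1 - 2 * k))) *
      normal_fun (b * s ^+ 2) s x)); last first.
    by rewrite [LHS]mulrACA [s * _]mulrA divff ?mul1r// gt_eqF.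
  congr (_ * _); rewrite /normal_fun -!expRD; congr expR.
  have -> : (s ^+ 2 *+ 2)^-1 = (1 - 2 * k) / 2.
    by rewrite s2 -mulr_natr invfM invrK.
  rewrite s2 expr1n [(2 * _)^-1]invfM; set w := 1 - 2 * k; set y := w^-1.
  have yw : y * w = 1 by rewrite mulVf// gt_eqF.
  have e1 : b * x * (y * w) = b * x by rewrite yw mulr1.
  have e2 : b ^+ 2 * y * (y * w) = b ^+ 2 * y by rewrite yw mulr1.
  by rewrite /w in e1 e2 *; move: (y) e1 e2 => z; lra.
rewrite ge0_integralZl//.
- by rewrite integral_normal_pdf mule1.
- by apply/measurable_EFinP; exact: measurable_normal_pdf.
- by move=> x _; rewrite lee_fin normal_pdf_ge0.
- by rewrite lee_fin mulr_ge0 ?expR_ge0// ltW.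
Qed.

(** * Exponential moments of a sum of squares *)

Lemma integral_expR_gaussian_law (R : realType) d (T : measurableType d)
    (P : probability T R) (S : T -> R) (m v : R) : 0 <= v ->
  measurable_fun setT (S : T -> measurableTypeR R) ->
  (forall A : set (measurableTypeR R), measurable A ->
     P [set w | A (S w)] = gaussian_law m v A) ->
  (\int[P]_w (expR (S w))%:E = (expR (m + v / 2))%:E)%E.
Proof.
move=> v0 mS lawS.
have mexp : measurable_fun setT (fun y : measurableTypeR R => (expR y)%:E).
  by apply/measurable_EFinP; exact: measurable_expR.
have -> : (\int[P]_w (expR (S w))%:E =
    \int[pushforward P (S : T -> measurableTypeR R)]_y (expR y)%:E)%E.
  by rewrite ge0_integral_pushforward// => y _; rewrite lee_fin expR_ge0.
have [vz|vn0] := eqVneq v 0.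
  rewrite (eq_measure_integral (\d_(m : measurableTypeR R))); last first.
    move=> A mA _; rewrite /pushforward -[LHS]/(P [set w | A (S w)]) lawS//.
    by rewrite /gaussian_law vz eqxx.
  by rewrite integral_dirac//= diracT mul1e vz mul0r addr0.
rewrite (eq_measure_integral (normal_prob m (Num.sqrt v))); last first.
  move=> A mA _; rewrite /pushforward -[LHS]/(P [set w | A (S w)]) lawS//.
  by rewrite /gaussian_law (negbTE vn0).
rewrite ge0_integral_normal_prob//.
under eq_integral => x _ do rewrite -[X in expR X]mul1r.
rewrite integral_expR_normal_pdf ?sqr_sqrtr// ?mul1r ?expr1n ?mul1r//.
by rewrite gt_eqF// sqrtr_gt0 lt_neqAle eq_sym vn0.
Qed.

(** Independent Gaussian variables X i of mean m i and variance 1, described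
    through the exponential moments of their linear combinations only. *)
Definition gaussian_mgf (R : realType) d (T : measurableType d)
    (P : probability T R) (I : finType) (X : I -> T -> R) (m : I -> R) :=
  forall a : I -> R,
  (\int[P]_w (expR (\sum_i a i * X i w))%:E =
   (expR (\sum_i (a i * m i + a i ^+ 2 / 2)))%:E)%E.

Section sum_of_squares.
Context (R : realType) d (T : measurableType d) (P : probability T R).
Context (I : finType) (X : I -> T -> R) (m : I -> R).
Hypothesis mX : forall i, measurable_fun setT (X i).
Hypothesis mgfX : gaussian_mgf P X m.

(** The squares are introduced one at a time, by induction on r.  Writing
    exp (l x^2) as the average of exp (c g x) over a standard normal g, with
    c^2 = 2 l, and exchanging the two integrals replaces the new square by the
    linear term c g X_i; the remaining integral in g is Gaussian.  The linear
    part a has to be general because each step modifies it. *)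
Lemma integral_expR_sqr_linear (l : R) (r : seq I) (a : I -> R) :
  0 <= l -> l < 1 / 2 -> uniq r ->
  (\int[P]_w (expR (l * \sum_(i <- r) X i w ^+ 2 + \sum_i a i * X i w))%:E =
   (expR (\sum_i (a i * m i + a i ^+ 2 / 2)) *
    \prod_(i <- r) ((Num.sqrt (1 - 2 * l))^-1 *
                    expR (l / (1 - 2 * l) * (m i + a i) ^+ 2)))%:E)%E.
Proof.
move=> l0 l2; elim: r a => [|i r IH] a /=.
  move=> _; rewrite big_nil mulr1 -(mgfX a).
  by apply: eq_integral => w _; rewrite big_nil mulr0 add0r.
move=> /andP[ir ur].
pose c := Num.sqrt (2 * l).
have c2 : c ^+ 2 = 2 * l by rewrite sqr_sqrtr// mulr_ge0.
pose f (w : T) (g : R) :=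
  l * (\sum_(j <- r) X j w ^+ 2) + \sum_j a j * X j w + c * X i w * g.
have mpdf : measurable_fun setT (fun g : measurableTypeR R => normal_pdf 0 1 g).
  exact: measurable_normal_pdf.
transitivity (\int[P]_w \int[lebesgue_measure]_g
    ((expR (f w g))%:E * (normal_pdf 0 1 g)%:E))%E.
  apply: eq_integral => w _.
  rewrite [in LHS]big_cons.
  under [RHS]eq_integral => g _ do rewrite /f expRD EFinM -muleA.
  rewrite ge0_integralZl//=.
  - rewrite integral_expR_normal_pdf// -EFinM -expRD; congr (expR _)%:E.
    by rewrite exprMn c2; lra.
  - apply/measurable_EFinP; apply: measurable_funM => //.
    by apply: measurableT_comp => //; exact: measurable_funM.
  - by move=> g _; rewrite mule_ge0 ?lee_fin ?expR_ge0 ?normal_pdf_ge0.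
rewrite (@sfinite_Fubini _ _ _ _ R P lebesgue_measure (fun z =>
    (expR (f z.1 z.2))%:E * (normal_pdf 0 1 z.2)%:E)%E)/=; last 2 first.
- by move=> [w g]; rewrite -EFinM lee_fin mulr_ge0 ?expR_ge0 ?normal_pdf_ge0.
- apply: emeasurable_funM; last first.
    by apply/measurable_EFinP; apply: measurableT_comp => //; exact: measurable_snd.
  apply/measurable_EFinP; apply: measurableT_comp => //.
  apply: measurable_funD.
    apply: measurable_funD.
      apply: measurable_funM => //; apply: measurable_sum => j.
      apply: measurable_funX; apply: (measurableT_comp (mX j)).
      exact: measurable_fst.
    apply: measurable_sum => j; apply: measurable_funM => //.
    by apply: (measurableT_comp (mX j)); exact: measurable_fst.
  apply: measurable_funM; last exact: measurable_snd.
  apply: measurable_funM => //.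
  by apply: (measurableT_comp (mX i)); exact: measurable_fst.
(* the linear part once the linearised square c g X_i has joined it *)
pose a' g j := if j == i then a j + c * g else a j.
pose Q := expR (\sum_i (a i * m i + a i ^+ 2 / 2)) *
    \prod_(i <- r) ((Num.sqrt (1 - 2 * l))^-1 *
                    expR (l / (1 - 2 * l) * (m i + a i) ^+ 2)).
transitivity (\int[lebesgue_measure]_g (Q%:E *
   ((expR (c * (m i + a i) * g + l * g ^+ 2))%:E * (normal_pdf 0 1 g)%:E)))%E.
  apply: eq_integral => g _.
  rewrite ge0_integralZr//; last 2 first.
  - apply/measurable_EFinP; apply: measurableT_comp => //.
    apply: measurable_funD; last first.
      by apply: measurable_funM => //; exact: measurable_funM.
    apply: measurable_funD.
      apply: measurable_funM => //; apply: measurable_sum => j.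
      exact: measurable_funX.
    by apply: measurable_sum => j; exact: measurable_funM.
  - by rewrite lee_fin normal_pdf_ge0.
  rewrite muleA; congr (_ * _)%E.
  have eqf w : f w g = l * (\sum_(j <- r) X j w ^+ 2) + \sum_j a' g j * X j w.
    rewrite /f -addrA; congr (_ + _).
    rewrite (bigD1 i)//= [in RHS](bigD1 i)//= /a' eqxx.
    under [in RHS]eq_bigr => j ji do rewrite (negbTE ji).
    by lra.
  under eq_integral => w _ do rewrite eqf.
  rewrite IH// -EFinM; congr (_%:E).
  rewrite /Q [RHS]mulrAC; congr (_ * _); last first.
    apply: eq_big_seq => j jr; rewrite /a'.
    by have [ji|//] := eqVneq j i; rewrite ji (negbTE ir) in jr.
  rewrite -expRD; congr expR.
  rewrite (bigD1 i)//= [in RHS](bigD1 i)//= /a' eqxx.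
  under eq_bigr => j ji do rewrite (negbTE ji).
  by rewrite sqrrD exprMn c2; lra.
rewrite ge0_integralZl//=.
- rewrite integral_expR_quadratic_normal_pdf// -EFinM big_cons /Q; congr (_%:E).
  rewrite [RHS]mulrCA [LHS]mulrC; congr (_ * expR _ * _).
  by rewrite exprMn c2 invfM; move: (1 - 2 * l)^-1 => y; lra.
- apply/measurable_EFinP; apply: measurable_funM => //.
  by apply: measurableT_comp => //; apply: measurable_funD; apply: measurable_funM.
- by move=> g _; rewrite mule_ge0 ?lee_fin ?expR_ge0 ?normal_pdf_ge0.
- by rewrite lee_fin mulr_ge0 ?expR_ge0// prodr_ge0.
Qed.

Lemma integral_expR_sum_sqr (l : R) : 0 <= l -> l < 1 / 2 ->
  (\int[P]_w (expR (l * \sum_i X i w ^+ 2))%:E =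
   ((Num.sqrt (1 - 2 * l))^-1 ^+ #|I| *
      expR (l / (1 - 2 * l) * \sum_i m i ^+ 2))%:E)%E.
Proof.
move=> l0 l2.
have /= := integral_expR_sqr_linear (fun=> 0) l0 l2 (index_enum_uniq I).
under eq_integral => w _.
  rewrite [X in _ + X]big1 ?addr0; last by move=> i _; rewrite mul0r.
  over.
move=> ->; congr (_%:E).
rewrite [X in expR X * _]big1 ?expR0 ?mul1r; last first.
  by move=> i _; rewrite mul0r expr0n/= mul0r addr0.
rewrite big_split/= prodr_const; congr (_ * _).
rewrite mulr_sumr expR_sum.
by apply: eq_bigr => i _; rewrite addr0.
Qed.
End sum_of_squares.

(** * Tails of chi-square laws *)

(** The square of the middle term is 1 / (1 - 2 l) = 1 + 2 l / (1 - 2 l). *)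
Lemma invsqrt_bounds (R : realType) (l : R) : 0 <= l -> l < 1 / 2 ->
  expR l <= (Num.sqrt (1 - 2 * l))^-1 <= expR (l / (1 - 2 * l)).
Proof.
move=> l0 l2; have u0 : 0 < 1 - 2 * l by lra.
have s0 : 0 < Num.sqrt (1 - 2 * l) by rewrite sqrtr_gt0.
have sqE x : Num.sqrt (expR (2 * x)) = expR x :> R.
  by rewrite (_ : expR (2 * x) = expR x ^+ 2) ?sqrtr_sqr ?gtr0_norm ?expR_gt0//
    -expRM_natl.
apply/andP; split.
  rewrite -[leLHS]invrK lef_pV2 ?posrE ?invr_gt0 ?expR_gt0// -expRN -sqE.
  by apply: ler_wsqrtr; have := expR_ge1Dx (2 * - l); lra.
rewrite -[in leLHS]sqrtrV ?(ltW u0)// -sqE; apply: ler_wsqrtr.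
have := expR_ge1Dx (2 * (l / (1 - 2 * l))).
have : (1 - 2 * l)^-1 * (1 - 2 * l) = 1 by rewrite mulVf// gt_eqF.
by move: (1 - 2 * l)^-1 => y; lra.
Qed.

Lemma tilt_bounds (R : realType) (l : R) : 0 <= l -> l <= 1 / 4 ->
  l <= l / (1 - 2 * l) <= l + 4 * l ^+ 2.
Proof.
move=> l0 l4; have u0 : 0 < 1 - 2 * l by lra.
by apply/andP; split; [rewrite ler_pdivlMr//|rewrite ler_pdivrMr//]; nra.
Qed.

Lemma expR_le_linear (R : realType) (k : R) : 0 < k -> k <= 1 / 256 ->
  expR (16 * k) <= 1 + 32 * k.
Proof.
move=> k0 k1; have := expR_ge1Dx (- (16 * k)); rewrite expRN => h.
have u0 : 0 < 1 + - (16 * k) by lra.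
rewrite -[leLHS]invrK; apply: (@le_trans _ _ (1 + - (16 * k))^-1).
  by rewrite lef_pV2 ?posrE ?invr_gt0 ?expR_gt0.
by rewrite -[leLHS]mul1r ler_pdivrMr//; nra.
Qed.

(** The tilt used in the lower tail is l = sqrt k / sqrt (D + M). *)
Lemma exists_tilt (R : realType) (k D M : R) : 1 <= D -> 0 < k -> k <= 1 / 256 ->
  0 < M -> 8 * Num.sqrt D <= k * M ->
  exists l, [/\ 0 < l, l <= 1 / 16, l ^+ 2 * (D + M) = k & 2 <= l * M].
Proof.
move=> D1 k0 k1 M0 Mlarge.
set q := Num.sqrt D in Mlarge.
have q1 : 1 <= q by rewrite -[leLHS]sqrtr1; apply: ler_wsqrtr.
have q2 : q ^+ 2 = D by rewrite sqr_sqrtr//; lra.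
set S := Num.sqrt (D + M).
have S2 : S ^+ 2 = D + M by rewrite sqr_sqrtr//; lra.
have S1 : 1 <= S by rewrite -[leLHS]sqrtr1; apply: ler_wsqrtr; lra.
set e := Num.sqrt k.
have e2 : e ^+ 2 = k by rewrite sqr_sqrtr ?ltW.
have e0 : 0 < e by rewrite sqrtr_gt0.
clearbody e S q.
have e16 : e <= 1 / 16.
  by rewrite -ler_sqr ?nnegrE ?(ltW e0)// e2; lra.
have S0 : 0 < S by lra.
exists (e / S); split.
- by rewrite divr_gt0.
- by rewrite ler_pdivrMr//; nra.
- by rewrite -S2 expr_div_n divfK ?expf_neq0 ?gt_eqF.
have Sge0 := ltW S0; have ege0 := ltW e0; have Mge0 := ltW M0.
rewrite mulrAC ler_pdivlMr// -ler_sqr ?nnegrE ?mulr_ge0//.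
rewrite !exprMn S2 e2.
have kM : 8 * q * M <= k * M * M by rewrite ler_pM2r.
have qM : q <= M by nra.
have : M <= q * M by rewrite ler_peMl.
have : D <= q * M by rewrite -q2 expr2 ler_pM2l//; lra.
rewrite expr2; nra.
Qed.

(** Integrate the pointwise inequality
    (mu - z)^2 * 1_(Z <= z) + 2 mu Z <= Z^2 + mu^2, a form of Chebyshev's
    inequality in which every term is nonnegative. *)
Lemma prob_le_second_moment (R : realType) d (T : measurableType d)
    (P : probability T R) (Z : T -> R) (mu s z : R) :
  measurable_fun setT Z -> (forall w, 0 <= Z w) ->
  (\int[P]_w (Z w)%:E = mu%:E)%E -> (\int[P]_w (Z w ^+ 2)%:E = s%:E)%E ->
  z < mu ->
  (P [set w | (Z w <= z)%R] <= ((s - mu ^+ 2) / (mu - z) ^+ 2)%:E)%E.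
Proof.
move=> mZ Z0 EZ EZ2 zmu.
set A := [set w | Z w <= z].
have mA : measurable A by rewrite -[A]setTI; apply: measurable_fun_le.
have PA : P A \is a fin_num by rewrite fin_num_measure.
have mu0 : 0 <= mu.
  by rewrite -lee_fin -EZ; apply: integral_ge0 => w _; rewrite lee_fin.
have le1 : (\int[P]_w (((mu - z) ^+ 2)%:E * (\1_A w)%:E + (2 * mu)%:E * (Z w)%:E)
    <= \int[P]_w ((Z w ^+ 2)%:E + (mu ^+ 2)%:E))%E.
  apply: ge0_le_integral => //.
  - move=> w _; rewrite -!EFinM -EFinD lee_fin.
    by rewrite addr_ge0// mulr_ge0 ?sqr_ge0// mulr_ge0.
  - by apply/measurable_EFinP; apply: measurable_funD; apply: measurable_funM.
  - by apply/measurable_EFinP; apply: measurable_funD => //; exact: measurable_funX.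
  - move=> w _; rewrite -!EFinM -!EFinD lee_fin indicE.
    have [/set_mem/= Zz|_] := boolP (w \in A); last first.
      by rewrite mulr0 add0r -subr_ge0 (_ : _ - _ = (Z w - mu) ^+ 2) ?sqr_ge0//; lra.
    rewrite mulr1 -subr_ge0 (_ : _ - _ = (z - Z w) * (2 * mu - z - Z w)); last lra.
    by have {}Zz : Z w <= z := Zz; rewrite mulr_ge0//; lra.
move: le1; rewrite ge0_integralD//; last 4 first.
- by move=> w _; rewrite -EFinM lee_fin mulr_ge0 ?sqr_ge0.
- by apply/measurable_EFinP; apply: measurable_funM => //; exact: measurable_indic.
- by move=> w _; rewrite -EFinM lee_fin mulr_ge0// mulr_ge0.
- by apply/measurable_EFinP; apply: measurable_funM.
rewrite ge0_integralZl//; last 2 first.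
- by apply/measurable_EFinP; exact: measurable_indic.
- by rewrite lee_fin sqr_ge0.
rewrite ge0_integralZl//; last 3 first.
- by apply/measurable_EFinP.
- by move=> w _; rewrite lee_fin.
- by rewrite lee_fin mulr_ge0.
rewrite integral_indic// setIT EZ.
rewrite ge0_integralD//; last 3 first.
- by move=> w _; rewrite lee_fin sqr_ge0.
- by apply/measurable_EFinP; exact: measurable_funX.
- by move=> w _; rewrite lee_fin sqr_ge0.
rewrite EZ2 integral_cst// [X in (_ <= _ + _ * X)%E]probability_setT mule1.
move=> H; rewrite -(fineK PA).
have {}H : (mu - z) ^+ 2 * fine (P A) + 2 * mu * mu <= s + mu ^+ 2.
  by rewrite -lee_fin !EFinD !(EFinM _ (fine _)) (fineK PA) EFinM.
by rewrite lee_fin ler_pdivlMr ?exprn_gt0 ?subr_gt0//; lra.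
Qed.

Section tails.
Context (R : realType) d (T : measurableType d) (P : probability T R).
Context (I : finType) (X : I -> T -> R) (m : I -> R).
Hypothesis mX : forall i, measurable_fun setT (X i).
Hypothesis mgfX : gaussian_mgf P X m.

Lemma measurable_sum_sqr : measurable_fun setT (fun w => \sum_i X i w ^+ 2).
Proof. by apply: measurable_sum => i; exact: measurable_funX. Qed.

(** The Chernoff bound, with (1 - 2 l)^(-1/2) at most exp (l + 4 l^2). *)
Lemma chi2_upper_tail_param (l x : R) : (forall i, m i = 0) ->
  0 < l -> l <= 1 / 4 ->
  (P [set w | (#|I|%:R + x <= \sum_i X i w ^+ 2)%R] <=
   (expR (4 * #|I|%:R * l ^+ 2 - l * x))%:E)%E.
Proof.
move=> m0 l0 l4.
have l2 : l < 1 / 2 by lra.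
pose Qmix := isMeasurableFun.Build _ _ _ _ _ measurable_sum_sqr.
pose Q : {mfun T >-> R} := HB.pack (fun w => \sum_i X i w ^+ 2) Qmix.
apply: (le_trans (chernoff (Q : {RV P >-> R}) (#|I|%:R + x) l0)).
rewrite /mmt_gen_fun unlock.
have -> : (\int[P]_w ((expR \o l \o* Q) w)%:E =
    \int[P]_w (expR (l * \sum_i X i w ^+ 2))%:E)%E.
  by apply: eq_integral => w _ /=; rewrite mulrC.
rewrite (integral_expR_sum_sqr mX mgfX (ltW l0) l2).
rewrite [X in expR (_ * X)]big1 ?mulr0 ?expR0 ?mulr1; last first.
  by move=> i _; rewrite m0 expr0n.
rewrite -EFinM lee_fin.
have /andP[_ D2] := invsqrt_bounds (ltW l0) l2.
have /andP[_ l'2] := tilt_bounds (ltW l0) l4.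
apply: (@le_trans _ _ (expR ((l + 4 * l ^+ 2) * #|I|%:R) *
    expR (- (l * (#|I|%:R + x))))).
  rewrite ler_wpM2r ?expR_ge0// [leRHS]expRM_natr.
  apply: lerXn2r; rewrite ?nnegrE ?invr_ge0 ?expR_ge0 ?sqrtr_ge0//.
  by apply: (le_trans D2); rewrite ler_expR.
by rewrite -expRD ler_expR; nra.
Qed.

(** The tilt is l = min(1, sqrt (L / d)) / 4 for d variables: the variance term
    4 d l^2 is then at most L / 4, and l (sqrt (d L) + L) is at least L / 4. *)
Lemma chi2_upper_tail (K L : R) : (forall i, m i = 0) -> (0 < #|I|)%N ->
  0 <= K -> 0 < L ->
  (P [set w | (#|I|%:R + K * (Num.sqrt (#|I|%:R * L) + L) <= \sum_i X i w ^+ 2)%R] <=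
   (expR (- ((K - 1) * L / 4)))%:E)%E.
Proof.
move=> m0 I0 K0 L0.
set D : R := #|I|%:R.
have D0 : 0 < D by rewrite ltr0n.
have [LD|DL] := leP L D.
  set r := Num.sqrt L; set q := Num.sqrt D.
  have r0 : 0 < r by rewrite sqrtr_gt0.
  have q0 : 0 < q by rewrite sqrtr_gt0.
  have r2 : r ^+ 2 = L by rewrite sqr_sqrtr ?ltW.
  have q2 : q ^+ 2 = D by rewrite sqr_sqrtr ?ltW.
  have l0 : 0 < r / q / 4 by rewrite !divr_gt0.
  have l4 : r / q / 4 <= 1 / 4.
    by rewrite ler_pM2r ?invr_gt0// ler_pdivrMr// mul1r ler_wsqrtr.
  apply: (le_trans (chi2_upper_tail_param _ m0 l0 l4)).
  rewrite lee_fin ler_expR -/D sqrtrM ?(ltW D0)// -/r -/q.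
  have -> : 4 * D * (r / q / 4) ^+ 2 = L / 4.
    rewrite !exprMn !exprVn r2 q2.
    have : D * (L * D^-1) = L by rewrite mulrC divfK// gt_eqF.
    by move: D^-1 => y; lra.
  have -> : r / q / 4 * (K * (q * r + L)) = K * L / 4 + r / q / 4 * (K * L).
    rewrite -r2; have : K * r ^+ 2 * (q^-1 * q) = K * r ^+ 2.
      by rewrite mulVf ?mulr1// gt_eqF.
    by move: q^-1 => y; lra.
  have : 0 <= r / q / 4 * (K * L) by rewrite !mulr_ge0 ?invr_ge0// ltW.
  lra.
have l4 : (1 / 4 : R) <= 1 / 4 by [].
have l0 : (0 < 1 / 4 :> R) by lra.
apply: (le_trans (chi2_upper_tail_param _ m0 l0 l4)).
rewrite lee_fin ler_expR -/D.
have : 0 <= K * Num.sqrt (D * L) by rewrite mulr_ge0 ?sqrtr_ge0.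
lra.
Qed.

End tails.

(** Second-moment method on the variable Z = exp (l Q), whose first two moments
    are values of the same closed form at l and 2 l.  With l of order
    sqrt k / sqrt (d + M), where d is the number of variables and M the squared
    length of the mean, the ratio of E Z^2 to (E Z)^2 is 1 + O(k), while
    t <= d + M / 2 puts exp (l t) below half of E Z as soon as l M >= 2; this
    is where k M must dominate sqrt d. *)
Lemma noncentral_chi2_lower_tail (R : realType) d (T : measurableType d)
    (P : probability T R) (I : finType) (X : I -> T -> R) (m : I -> R) (k t : R) :
  (forall i, measurable_fun setT (X i)) ->
  gaussian_mgf P X m ->
  0 < k -> k <= 1 / 256 ->
  (0 < #|I|)%N ->
  8 * Num.sqrt #|I|%:R <= k * \sum_i m i ^+ 2 ->
  t <= #|I|%:R + (\sum_i m i ^+ 2) / 2 ->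
  (P [set w | (\sum_i X i w ^+ 2 < t)%R] <= (128 * k)%:E)%E.
Proof.
move=> mX mgfX k0 k1 I0 Mlarge tle.
set M := \sum_i m i ^+ 2 in Mlarge tle *.
set D : R := #|I|%:R in Mlarge tle *.
have D1 : 1 <= D by rewrite ler1n.
have M0 : 0 < M.
  rewrite -(pmulr_rgt0 _ k0); apply: lt_le_trans Mlarge.
  by rewrite mulr_gt0// sqrtr_gt0 (lt_le_trans ltr01).
have [l [l0 l16 l2S lM]] := exists_tilt D1 k0 k1 M0 Mlarge.
pose Z w := expR (l * \sum_i X i w ^+ 2).
have ll2 : l < 1 / 2 by clear -l16; lra.
have l2l2 : 2 * l < 1 / 2 by clear -l16; lra.
have l4 : l <= 1 / 4 by clear -l16; lra.
have l24 : 2 * l <= 1 / 4 by clear -l16; lra.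
have l20 : 0 <= 2 * l by rewrite mulr_ge0// ltW.
have EZ := integral_expR_sum_sqr mX mgfX (ltW l0) ll2.
have EZ2 := integral_expR_sum_sqr mX mgfX l20 l2l2.
move: EZ EZ2; rewrite -/M.
set mu := (X in X%:E); set s := (X in _ -> _ = X%:E -> _) => EZ EZ2.
have mu_ge : expR (l * (D + M)) <= mu.
  rewrite mulrDr expRD; apply: ler_pM; rewrite ?expR_ge0//.
    rewrite /D expRM_natr; apply: lerXn2r;
      rewrite ?nnegrE ?expR_ge0 ?invr_ge0 ?sqrtr_ge0//.
    by have /andP[] := invsqrt_bounds (ltW l0) ll2.
  by rewrite ler_expR ler_pM2r//; have /andP[] := tilt_bounds (ltW l0) l4.
have s_le : s <= expR ((2 * l + 4 * (2 * l) ^+ 2) * (D + M)).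
  have /andP[_ tb] := tilt_bounds l20 l24.
  rewrite mulrDr expRD; apply: ler_pM;
    rewrite ?expR_ge0 ?exprn_ge0 ?invr_ge0//; last by rewrite ler_expR ler_pM2r.
  rewrite /D expRM_natr; apply: lerXn2r;
    rewrite ?nnegrE ?expR_ge0 ?invr_ge0 ?sqrtr_ge0//.
  have /andP[_ h] := invsqrt_bounds l20 l2l2.
  by apply: (le_trans h); rewrite ler_expR.
have mu0 : 0 < mu := lt_le_trans (expR_gt0 _) mu_ge.
have s_mu : s <= (1 + 32 * k) * mu ^+ 2.
  apply: (le_trans s_le).
  have -> : (2 * l + 4 * (2 * l) ^+ 2) * (D + M) = 16 * k + 2 * (l * (D + M)).
    by rewrite -l2S; clear; lra.
  rewrite expRD [expR (2 * _)]expRM_natl.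
  apply: ler_pM; rewrite ?expR_ge0 ?exprn_ge0 ?expR_ge0//.
    exact: expR_le_linear.
  by apply: lerXn2r; rewrite ?nnegrE ?expR_ge0 ?(ltW mu0).
set z := expR (l * t).
have z_mu : z <= mu / 2.
  apply: (@le_trans _ _ (expR (l * (D + M)) * expR (- 1))).
    rewrite -expRD ler_expR.
    have : l * t <= l * (D + M / 2) by rewrite ler_pM2l.
    by clear -lM; nra.
  apply: ler_pM; rewrite ?expR_ge0// expRN lef_pV2 ?posrE ?expR_gt0//.
  by have := expR_ge1Dx (1 : R); clear; lra.
have zltmu : z < mu by clear -z_mu mu0; lra.
have mZ : measurable_fun setT Z.
  apply: measurableT_comp => //; apply: measurable_funM => //.
  exact: measurable_sum_sqr.
apply: (@le_trans _ _ (P [set w | Z w <= z])).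
  apply: le_measure; rewrite ?inE.
  - rewrite [X in measurable X](_ : _ = ~` [set w | t <= \sum_i X i w ^+ 2]).
      apply: measurableC; rewrite -[X in measurable X]setTI.
      by apply: measurable_fun_le => //; exact: measurable_sum_sqr.
    by apply/seteqP; split => w /=; rewrite ltNge => /negP.
  - by rewrite -[X in measurable X]setTI; apply: measurable_fun_le.
  - by move=> w /= Qt; rewrite /Z /z ler_expR ler_pM2l// ltW.
have EZ2' : (\int[P]_w (Z w ^+ 2)%:E = s%:E)%E.
  rewrite -EZ2; apply: eq_integral => w _; congr (_%:E).
  by rewrite /Z -expRM_natl mulrA.
apply: (le_trans (prob_le_second_moment mZ (fun w => expR_ge0 _) EZ EZ2' zltmu)).
rewrite lee_fin ler_pdivrMr ?exprn_gt0 ?subr_gt0//.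
have h : (mu / 2) ^+ 2 <= (mu - z) ^+ 2.
  by apply: lerXn2r; rewrite ?nnegrE; clear -z_mu mu0; lra.
have : 128 * k * (mu / 2) ^+ 2 <= 128 * k * (mu - z) ^+ 2.
  by rewrite ler_pM2l// mulr_gt0.
by rewrite expr_div_n; clear -s_mu; lra.
Qed.

(** * Square-integrable functions *)

Section L2.
Context (R : realType) d (T : measurableType d) (mu : {measure set T -> \bar R}).
Implicit Types f g : T -> R.

Lemma Lfun2_integrable_mul f g : f \in Lfun mu 2%:E -> g \in Lfun mu 2%:E ->
  mu.-integrable setT (EFin \o (fun x => f x * g x)).
Proof. by move=> Lf Lg; apply/Lfun1_integrable; exact: Lfun2_mul_Lfun1. Qed.

Lemma Lfun2_lincomb (I : Type) (r : seq I) (a : I -> R) (g : I -> T -> R) :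
  (forall i, g i \in Lfun mu 2%:E) ->
  (fun x => \sum_(i <- r) a i * g i x) \in Lfun mu 2%:E.
Proof.
move=> Lg; rewrite (_ : (fun _ => _) = \sum_(i <- r) a i *: g i).
  have [L0 Lcl] := @Lfun_submod_closed _ _ _ mu 2%:E (lee1n 2).
  elim: r => [|i r IH]; first by rewrite big_nil.
  by rewrite big_cons; exact: Lcl.
by apply/funext => x; rewrite fct_sumE.
Qed.

Lemma Lfun2_sub f g : f \in Lfun mu 2%:E -> g \in Lfun mu 2%:E ->
  (fun x => f x - g x) \in Lfun mu 2%:E.
Proof.
move=> Lf Lg; have [L0 Lcl] := @Lfun_submod_closed _ _ _ mu 2%:E (lee1n 2).
rewrite (_ : (fun x => f x - g x) = (-1) *: g + f); first exact: Lcl.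
by apply/funext => x; rewrite scaleN1r addrC.
Qed.

Lemma Rintegral_mul_lincomb (I : Type) (r : seq I) (a : I -> R) f (g : I -> T -> R) :
  f \in Lfun mu 2%:E -> (forall i, g i \in Lfun mu 2%:E) ->
  \int[mu]_x (f x * \sum_(i <- r) a i * g i x) =
  \sum_(i <- r) a i * \int[mu]_x (f x * g i x).
Proof.
move=> Lf Lg; elim: r => [|i r IH].
  under eq_Rintegral => x _ do rewrite big_nil mulr0.
  by rewrite big_nil /Rintegral integral0.
under eq_Rintegral => x _ do rewrite big_cons mulrDr mulrCA.
rewrite RintegralD//; last 2 first.
- rewrite (_ : EFin \o _ = (fun x => (a i)%:E * (f x * g i x)%:E)%E)//.
  by apply: integrableZl => //; exact: Lfun2_integrable_mul.
- by apply: Lfun2_integrable_mul => //; exact: Lfun2_lincomb.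
by rewrite RintegralZl ?big_cons ?IH//; exact: Lfun2_integrable_mul.
Qed.

Lemma Rintegral_sqr_orthonormal (I : finType) (a : I -> R) (g : I -> T -> R) :
  (forall i, g i \in Lfun mu 2%:E) ->
  (forall i j, \int[mu]_x (g i x * g j x) = (i == j)%:R) ->
  \int[mu]_x ((\sum_i a i * g i x) ^+ 2) = \sum_i a i ^+ 2.
Proof.
move=> Lg og; under eq_Rintegral => x _ do rewrite expr2.
rewrite Rintegral_mul_lincomb//; last exact: Lfun2_lincomb.
apply: eq_bigr => i _; under eq_Rintegral => x _ do rewrite mulrC.
rewrite Rintegral_mul_lincomb// (bigD1 i)//= og eqxx mulr1 big1 ?addr0//.
by move=> j ji; rewrite og eq_sym (negbTE ji) mulr0.
Qed.

Lemma Lnorm2E f : f \in Lfun mu 2%:E ->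
  'N[mu]_2%:E[EFin \o f]%E = (Num.sqrt (\int[mu]_x (f x ^+ 2)))%:E.
Proof.
move=> Lf; rewrite unlock /Lnorm.
have -> : (\int[mu]_x (`|(EFin \o f) x| `^ 2) = (\int[mu]_x (f x ^+ 2))%:E)%E.
  rewrite /Rintegral fineK; last first.
    by apply: integrable_fin_num => //; exact: Lfun2_integrable_sqr.
  apply: eq_integral => x _.
  by rewrite /= powR_mulrn// real_normK// num_real.
by rewrite poweR_EFin powR12_sqrt// Rintegral_ge0// => x _; exact: sqr_ge0.
Qed.

Lemma cauchy_schwarz_Rintegral f g : f \in Lfun mu 2%:E -> g \in Lfun mu 2%:E ->
  `|\int[mu]_x (f x * g x)| <=
  Num.sqrt (\int[mu]_x (f x ^+ 2)) * Num.sqrt (\int[mu]_x (g x ^+ 2)).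
Proof.
move=> Lf Lg; have mf : measurable_fun setT f.
  by have /andP[/set_mem] := Lf.
have mg : measurable_fun setT g by have /andP[/set_mem] := Lg.
have h2 : (2^-1 + 2^-1 = 1 :> R) by rewrite [RHS]splitr !div1r.
have H := @hoelder _ _ _ mu f g 2 2 mf mg (ltr0n _ 2) (ltr0n _ 2) h2.
rewrite -lee_fin EFinM -!Lnorm2E//; apply: le_trans H.
rewrite Lnorm1 EFin_normr_Rintegral//; last exact: Lfun2_integrable_mul.
apply: le_abse_integral => //.
by apply/measurable_EFinP; exact: measurable_funM.
Qed.
End L2.

(** * Marginal laws of the coordinates of the cube *)

Section product_marginals.
Context (R : realType) d1 d2 (T1 : measurableType d1) (T2 : measurableType d2).
Context (P1 : probability T1 R) (P2 : probability T2 R).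

Lemma product_probabilityE (A : set T1) (B : set T2) :
  measurable A -> measurable B -> (P1 \x P2)%E (A `*` B) = (P1 A * P2 B)%E.
Proof. exact: product_measure1E. Qed.

Lemma product_probabilityTl (B : set T2) : measurable B ->
  (P1 \x P2)%E (setT `*` B) = P2 B.
Proof.
by move=> mB; rewrite product_measure1E// [X in (X * _)%E]probability_setT mul1e.
Qed.

Lemma product_probabilityTr (A : set T1) : measurable A ->
  (P1 \x P2)%E (A `*` setT) = P1 A.
Proof.
by move=> mA; rewrite product_measure1E// [X in (_ * X)%E]probability_setT mule1.
Qed.
End product_marginals.

Section cube.
Context (R : realType).
Local Notation unit_leb := (@unit_leb R).

Lemma cube_leb_cons q (S : set (cube R q.+1)) :
  cube_leb q.+1 S = (unit_leb \x cube_leb q)%E [set z | S (Defs.cons_tuple z)].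
Proof. by []. Qed.

Lemma measurable_tnth_preimage p (j : 'I_p) (A : set (measurableTypeR R)) :
  measurable A -> measurable [set x : cube R p | A (tnth x j)].
Proof.
by move=> mA; rewrite -[X in measurable X]setTI; exact: measurable_tnth.
Qed.

Lemma cube_leb_tnth p (j : 'I_p) (A : set (measurableTypeR R)) : measurable A ->
  cube_leb p [set x | A (tnth x j)] = unit_leb A.
Proof.
move=> mA; elim: p j => [[]//|q IH] j.
rewrite cube_leb_cons; have [j'|j0] := unliftP ord0 j.
  move=> ->.
  rewrite (_ : [set z | _] = setT `*` [set x | A (tnth x j')]); last first.
    by apply/seteqP; split => -[u x] /=; rewrite /Defs.cons_tuple tnthS// => -[].
  rewrite product_probabilityTl; last exact: measurable_tnth_preimage.
  exact: IH.
rewrite j0 (_ : [set z | _] = A `*` setT); last first.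
  by apply/seteqP; split => -[u x] /=; rewrite /Defs.cons_tuple tnth0// => -[].
by rewrite product_probabilityTr.
Qed.

Lemma cube_leb_tnth2 p (i j : 'I_p) (A B : set (measurableTypeR R)) : i != j ->
  measurable A -> measurable B ->
  cube_leb p [set x | A (tnth x i) /\ B (tnth x j)] =
  (unit_leb A * unit_leb B)%E.
Proof.
move=> + mA mB; elim: p i j => [[]//|q IH] i j.
rewrite cube_leb_cons.
have [i' ->|->] := unliftP ord0 i; have [j' ->|->] := unliftP ord0 j.
- rewrite (inj_eq lift_inj) => ij.
  rewrite (_ : [set z | _] =
    setT `*` [set x | A (tnth x i') /\ B (tnth x j')]); last first.
    by apply/seteqP; split => -[u x] /=; rewrite /Defs.cons_tuple !tnthS// => -[].
  rewrite product_probabilityTl; first exact: IH.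
  by apply: measurableI; exact: measurable_tnth_preimage.
- move=> _; rewrite (_ : [set z | _] = B `*` [set x | A (tnth x i')]); last first.
    by apply/seteqP; split => -[u x] /=; rewrite /Defs.cons_tuple tnthS tnth0// => -[].
  rewrite product_probabilityE//; last exact: measurable_tnth_preimage.
  by rewrite cube_leb_tnth// muleC.
- move=> _; rewrite (_ : [set z | _] = A `*` [set x | B (tnth x j')]); last first.
    by apply/seteqP; split => -[u x] /=; rewrite /Defs.cons_tuple tnthS tnth0// => -[].
  rewrite product_probabilityE//; last exact: measurable_tnth_preimage.
  by rewrite cube_leb_tnth.
- by rewrite eqxx.
Qed.
End cube.

Section cube_integrals.
Context (R : realType).
Local Notation unit_leb := (@unit_leb R).

Lemma ge0_integral_cube_tnth p (j : 'I_p) (F : measurableTypeR R -> \bar R) :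
  measurable_fun setT F -> (forall u, 0 <= F u)%E ->
  (\int[cube_leb p]_x F (tnth x j) = \int[unit_leb]_u F u)%E.
Proof.
move=> mF F0.
have mt : measurable_fun setT (fun x : cube R p => tnth x j).
  exact: measurable_tnth.
transitivity (\int[pushforward (cube_leb p) (fun x : cube R p => tnth x j)]_u F u)%E.
  by rewrite ge0_integral_pushforward.
by apply: eq_measure_integral => A mA _; exact: cube_leb_tnth.
Qed.

Lemma Rintegral_cube_tnth p (j : 'I_p) (F : measurableTypeR R -> R) :
  measurable_fun setT F ->
  \int[cube_leb p]_x F (tnth x j) = \int[unit_leb]_u F u.
Proof.
move=> mF; congr fine; rewrite integralE [RHS]integralE; congr (_ - _)%E.
  rewrite -(@ge0_integral_cube_tnth _ j)//; last first.
    exact/measurable_funepos/measurable_EFinP.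
  by apply: eq_integral => x _; rewrite !funeposE.
rewrite -(@ge0_integral_cube_tnth _ j)//; last first.
  exact/measurable_funeneg/measurable_EFinP.
by apply: eq_integral => x _; rewrite !funenegE.
Qed.

Lemma Lfun_cube_tnth p (j : 'I_p) (F : measurableTypeR R -> R) :
  F \in Lfun unit_leb 2%:E ->
  (fun x : cube R p => F (tnth x j)) \in Lfun (cube_leb p) 2%:E.
Proof.
move=> /andP[/set_mem/= mF /set_mem/= fF].
have mt : measurable_fun setT (fun x : cube R p => tnth x j).
  exact: measurable_tnth.
apply/andP; split; rewrite inE/=; first exact: (measurableT_comp mF mt).
move: fF; rewrite /finite_norm unlock /Lnorm.
rewrite -(@ge0_integral_cube_tnth _ j)//; last first.
  by move=> u; exact: poweR_ge0.
apply/measurable_EFinP; apply: (measurableT_comp (measurable_powR _)).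
exact: measurableT_comp.
Qed.

(** The pair (x_i, x_j) has the product law, so that Fubini's theorem lets the
    integral of v factor out. *)
Lemma Rintegral_cube_tnth2_eq0 p (i j : 'I_p) (u v : measurableTypeR R -> R) :
  i != j -> u \in Lfun unit_leb 2%:E -> v \in Lfun unit_leb 2%:E ->
  \int[unit_leb]_x v x = 0 ->
  \int[cube_leb p]_x (u (tnth x i) * v (tnth x j)) = 0.
Proof.
move=> ij Lu Lv v0.
have mu : measurable_fun setT u by have /andP[/set_mem] := Lu.
have mv : measurable_fun setT v by have /andP[/set_mem] := Lv.
have fT : unit_leb setT \is a fin_num by rewrite fin_num_measure.
have iu : unit_leb.-integrable setT (EFin \o u).
  by apply/Lfun1_integrable; exact: Lfun_subset12.
have iv : unit_leb.-integrable setT (EFin \o v).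
  by apply/Lfun1_integrable; exact: Lfun_subset12.
have mt : measurable_fun setT (fun x : cube R p => (tnth x i, tnth x j)).
  by apply/measurable_fun_pair; exact: measurable_tnth.
pose f (z : measurableTypeR R * measurableTypeR R) := (u z.1 * v z.2)%:E.
have mf : measurable_fun setT f.
  apply/measurable_EFinP; apply: measurable_funM.
    by apply: (measurableT_comp mu); exact: measurable_fst.
  by apply: (measurableT_comp mv); exact: measurable_snd.
have int_f : (unit_leb \x unit_leb)%E.-integrable setT f.
  apply/integrable12ltyP => //=.
  under eq_integral => x _.
    under eq_integral => y _ do rewrite normrM EFinM.
    rewrite ge0_integralZl//; last first.
      by apply/measurable_EFinP; apply: measurableT_comp.
    over.
  rewrite ge0_integralZr//; last 2 first.
  - by apply/measurable_EFinP; apply: measurableT_comp.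
  - by apply: integral_ge0 => y _; rewrite lee_fin.
  move/integrableP : iu => [_ iu]; move/integrableP : iv => [_ iv].
  by rewrite lte_mul_pinfty ?ge0_fin_numE ?integral_ge0//.
have E : (\int[cube_leb p]_x (u (tnth x i) * v (tnth x j))%:E = 0)%E.
  transitivity (\int[pushforward (cube_leb p)
      (fun x : cube R p => (tnth x i, tnth x j))]_z f z)%E.
    rewrite integral_pushforward//.
    apply: (@Lfun2_integrable_mul _ _ _ _ (fun x : cube R p => u (tnth x i))
      (fun x => v (tnth x j)));
      exact: Lfun_cube_tnth.
  transitivity (\int[(unit_leb \x unit_leb)%E]_z f z)%E.
    apply: eq_measure_integral => A mA _; apply/esym.
    apply: product_measure_unique => // B C mB mC.
    exact: cube_leb_tnth2.
  rewrite -integral12_prod_meas1//.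
  rewrite integral0_eq// => x _; rewrite /fubini_F /f/=.
  under eq_integral => y _ do rewrite EFinM.
  rewrite integralZl//.
  by rewrite -[X in (_ * X)%E]fineK ?integrable_fin_num// -/(Rintegral _ _ v) v0 mule0.
by rewrite /Rintegral E.
Qed.

Variable psi : nat -> measurableTypeR R -> R.
Hypothesis psi_on : orthonormal_centered psi.

Lemma basis_fun_Lfun p k (j : 'I_p) : (0 < k)%N ->
  basis_fun psi k j \in Lfun (cube_leb p) 2%:E.
Proof. by case: psi_on => Lpsi _ _ k0; apply: Lfun_cube_tnth; exact: Lpsi. Qed.

Lemma basis_fun_orthonormal p k l (i j : 'I_p) : (0 < k)%N -> (0 < l)%N ->
  \int[cube_leb p]_x (basis_fun psi k i x * basis_fun psi l j x) =
  ((k == l) && (i == j))%:R.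
Proof.
case: psi_on => Lpsi ortho cent k0 l0; rewrite /basis_fun.
have [->|ij] := eqVneq i j; last first.
  by rewrite andbF Rintegral_cube_tnth2_eq0//; [exact: Lpsi|exact: Lpsi|exact: cent].
rewrite andbT -ortho// (@Rintegral_cube_tnth _ j (fun u => psi k u * psi l u))//.
have /andP[/set_mem/= mk _] := Lpsi _ k0; have /andP[/set_mem/= ml _] := Lpsi _ l0.
exact: measurable_funM.
Qed.
End cube_integrals.

(** * Coefficients of a signal *)

Section signal.
Context (R : realType) (psi : nat -> measurableTypeR R -> R) (p : nat).
Hypothesis psi_on : orthonormal_centered psi.

(** The basis functions of frequency at most N; the position k : 'I_N stands for
    the frequency k + 1. *)
Definition basis_block N (z : 'I_p * 'I_N) : cube R p -> R :=
  basis_fun psi z.2.+1 z.1.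

Lemma sum_block (V : nmodType) N (F : nat -> 'I_p -> V) :
  \sum_(j < p) \sum_(1 <= k < N.+1) F k j = \sum_(z : 'I_p * 'I_N) F z.2.+1 z.1.
Proof.
rewrite -(pair_bigA _ (fun (j : 'I_p) (k : 'I_N) => F k.+1 j))/=.
by apply: eq_bigr => j _; rewrite big_add1 big_mkord.
Qed.

Lemma basis_block_Lfun N (z : 'I_p * 'I_N) :
  basis_block z \in Lfun (cube_leb p) 2%:E.
Proof. exact: basis_fun_Lfun. Qed.

Lemma basis_block_orthonormal N (y z : 'I_p * 'I_N) :
  \int[cube_leb p]_x (basis_block y x * basis_block z x) = (y == z)%:R.
Proof.
rewrite basis_fun_orthonormal//; case: y z => [i k] [j l] /=.
by rewrite eqSS xpair_eqE andbC.
Qed.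

Section coefficients.
Context (theta : nat -> 'I_p -> R) (f : cube R p -> R).
Hypothesis Lf : f \in Lfun (cube_leb p) 2%:E.

Let S N (x : cube R p) :=
  \sum_(j < p) \sum_(1 <= k < N.+1) theta k j * basis_fun psi k j x.

Hypothesis Sf : (fun N => 'N[cube_leb p]_2%:E[EFin \o (fun x => f x - S N x)%R]%E)
  @ \oo --> 0%E.

Let SE N : S N = fun x => \sum_(z : 'I_p * 'I_N) theta z.2.+1 z.1 * basis_block z x.
Proof.
apply/funext => x; rewrite /S.
exact: (sum_block _ (fun k j => theta k j * basis_fun psi k j x)).
Qed.

Let LS N : S N \in Lfun (cube_leb p) 2%:E.
Proof. by rewrite SE; apply: Lfun2_lincomb => z; exact: basis_block_Lfun. Qed.

Let LfS N : (fun x => f x - S N x) \in Lfun (cube_leb p) 2%:E.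
Proof.
exact: Lfun2_sub.
Qed.

Let err N := Num.sqrt (\int[cube_leb p]_x ((f x - S N x) ^+ 2)).

Let err_small e : 0 < e -> exists N0, forall N, (N0 <= N)%N -> err N < e.
Proof.
move=> e0; move: Sf => /fine_cvgP[_ /cvgrPdist_lt /(_ _ e0)[N0 _ H]].
exists N0 => N /H /=; rewrite (Lnorm2E (LfS N))/= sub0r normrN ger0_norm//.
Qed.

(** The partial sum of order N >= k has the coefficient theta k j, and by the
    Cauchy-Schwarz inequality the coefficients of f and of its partial sums
    differ by at most the norm of the remainder. *)
Lemma coefE k j : (0 < k)%N ->
  \int[cube_leb p]_x (f x * basis_fun psi k j x) = theta k j.
Proof.
move=> k0; apply/eqP; rewrite -subr_eq0 -normr_le0; apply/ler_addgt0Pr => e e0.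
rewrite add0r.
have [N0 HN] := err_small e0.
pose N := maxn N0 k.
have kN : (k.-1 < N)%N by rewrite prednK// leq_maxr.
apply: le_trans (ltW (HN N (leq_maxl _ _))).
pose z0 : 'I_p * 'I_N := (j, Ordinal kN).
have gz : basis_fun psi k j = basis_block z0 by rewrite /basis_block/= prednK.
have nz : \int[cube_leb p]_x (basis_block z0 x ^+ 2) = 1.
  by under eq_Rintegral do rewrite expr2; rewrite basis_block_orthonormal eqxx.
have Lg := basis_block_Lfun z0.
have -> : \int[cube_leb p]_x (f x * basis_fun psi k j x) - theta k j =
    \int[cube_leb p]_x ((f x - S N x) * basis_block z0 x).
  rewrite gz; under [RHS]eq_Rintegral do rewrite mulrBl.
  rewrite RintegralB//; [|exact: Lfun2_integrable_mul..].
  congr (_ - _); under eq_Rintegral do rewrite mulrC SE.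
  rewrite Rintegral_mul_lincomb//; last by move=> z; exact: basis_block_Lfun.
  rewrite (bigD1 z0)//= basis_block_orthonormal eqxx mulr1 big1 ?addr0 ?prednK//.
  by move=> z zz0; rewrite basis_block_orthonormal eq_sym (negbTE zz0) mulr0.
by have := cauchy_schwarz_Rintegral (LfS N) Lg; rewrite nz sqrtr1 mulr1.
Qed.

(** The triangle inequality, applied to f - S N and S N for large N. *)
Lemma Lnorm_le_coef (B : R) :
  (forall N, \sum_(j < p) \sum_(1 <= k < N.+1) theta k j ^+ 2 <= B) ->
  ('N[cube_leb p]_2%:E[EFin \o f] <= (Num.sqrt B)%:E)%E.
Proof.
move=> HB; rewrite Lnorm2E// lee_fin; apply/ler_addgt0Pr => e e0.
have [N /(_ N (leqnn _)) HN] := err_small e0.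
have mS : measurable_fun setT (S N) by have /andP[/set_mem] := LS N.
have mfS : measurable_fun setT (fun x => f x - S N x).
  by have /andP[/set_mem] := LfS N.
have H := @minkowski_EFin _ _ _ (cube_leb p) (fun x => f x - S N x) (S N) 2
  mfS mS (ler1n _ 2).
rewrite (_ : _ \+ _ = f) in H; last by apply/funext => x /=; rewrite subrK.
move: H; rewrite !Lnorm2E// -EFinD lee_fin => /le_trans; apply.
rewrite addrC lerD// ?(ltW HN)//; apply: ler_wsqrtr.
rewrite SE Rintegral_sqr_orthonormal//; last 2 first.
- by move=> z; exact: basis_block_Lfun.
- by move=> y z; exact: basis_block_orthonormal.
by rewrite -(sum_block _ (fun k j => theta k j ^+ 2)).
Qed.
End coefficients.

(** Beyond frequency nu each weight k^(- 2 alpha) is at most x^(- 2 alpha), so the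
    ellipsoid constraint bounds the tail of each of the at most s nonzero
    columns.  The real number x is kept apart from nu + 1 because the rates are
    stated at the real frequency that nu rounds up. *)
Lemma coef_space_tail (s nu N : nat) (alpha x : R) (theta : nat -> 'I_p -> R) :
  coef_space s alpha theta -> 0 < alpha -> 0 < x -> x <= nu.+1%:R ->
  \sum_(j < p) \sum_(1 <= k < N.+1) theta k j ^+ 2 <=
  \sum_(j < p) \sum_(1 <= k < nu.+1) theta k j ^+ 2 + s%:R * x `^ (- (2 * alpha)).
Proof.
move=> [supp ell] a0 x0 xnu.
pose A := [set j | `[< exists2 k, (0 < k)%N & (theta k j != 0)%R >]]%SET.
apply: (@le_trans _ _ (\sum_(j < p) (\sum_(1 <= k < nu.+1) theta k j ^+ 2 +
   (j \in A)%:R * x `^ (- (2 * alpha))))); last first.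
  rewrite big_split/= lerD2l -mulr_suml ler_wpM2r ?powR_ge0//.
  by rewrite -natr_sum ler_nat -sum1_card big_mkcond/= in supp *.
apply: ler_sum => j _.
have [jA|jA] := boolP (j \in A); last first.
  rewrite mul0r addr0 big_nat_cond big1.
    by apply: sumr_ge0 => k _; exact: sqr_ge0.
  move=> k /andP[/andP[k0 _] _].
  apply/eqP; rewrite sqrf_eq0; apply: contraNT jA => tk.
  by rewrite inE; apply/asboolP; exists k.
rewrite mul1r.
have part : \sum_(1 <= k < N.+1) (theta k j ^+ 2 / k%:R `^ (- (2 * alpha))) <= 1.
  rewrite -lee_fin; apply: le_trans (ell j); rewrite -sumEFin.
  apply: nneseries_lim_ge => k _ _; rewrite lee_fin divr_ge0 ?sqr_ge0 ?powR_ge0//.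
apply: (@le_trans _ _ (\sum_(1 <= k < N.+1)
    ((if (k <= nu)%N then theta k j ^+ 2 else 0) +
   x `^ (- (2 * alpha)) * (theta k j ^+ 2 / k%:R `^ (- (2 * alpha)))))).
  rewrite big_nat_cond [leRHS]big_nat_cond; apply: ler_sum => k /andP[/andP[k0 _] _].
  have [knu|nuk] := leqP k nu.
    by rewrite lerDl mulr_ge0 ?divr_ge0 ?sqr_ge0 ?powR_ge0.
  rewrite add0r mulrCA ler_peMr ?sqr_ge0//.
  have k0' : 0 < k%:R :> R by rewrite ltr0n.
  rewrite ler_pdivlMr ?powR_gt0// mul1r !powRN lef_pV2 ?posrE ?powR_gt0//.
  by apply: ge0_ler_powR; rewrite ?nnegrE ?mulr_ge0 ?(ltW a0) ?(ltW x0) ?(ltW k0')//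
    (le_trans xnu)// ler_nat.
rewrite big_split/=; apply: lerD; last first.
  by rewrite -mulr_sumr ler_piMr ?powR_ge0.
rewrite -big_mkcond/=.
have [Nnu|nuN] := leqP N nu.
  rewrite (@big_cat_nat _ _ _ N.+1 1 nu.+1)//= big_nat_cond.
  rewrite [X in _ <= X + _]big_nat_cond.
  rewrite (eq_bigl (fun k => (1 <= k < N.+1)%N && true)).
    by rewrite lerDl sumr_ge0// => k _; exact: sqr_ge0.
  move=> k; rewrite andbT; case: (boolP (_ < _ < _)%N) => //= /andP[_ kN].
  by rewrite (leq_trans (kN : (k <= N)%N) Nnu).
rewrite (@big_cat_nat _ _ _ nu.+1 1 N.+1)//=; last exact: leqW.
rewrite [X in _ + X]big_nat_cond [X in _ + X]big1; last first.
  by move=> k /andP[/andP[nuk _]]; rewrite leqNgt nuk.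
rewrite addr0 big_nat_cond [leRHS]big_nat_cond.
rewrite (eq_bigl (fun k => (1 <= k < nu.+1)%N && true))// => k.
by rewrite ltnS andbT -andbA andbb.
Qed.
End signal.

(** * Exponential moments of the data *)

Section white_noise.
Context (R : realType) (p n : nat) (psi : nat -> measurableTypeR R -> R).
Context d (T : measurableType d).
Context (Y : (cube R p -> R) -> {mfun T >-> measurableTypeR R}).
Context (P : (cube R p -> R) -> probability T R).
Hypothesis n_gt0 : (0 < n)%N.
Hypothesis psi_on : orthonormal_centered psi.
Hypothesis white : gaussian_white_noise n Y P.

(** Rescaled by sqrt n, the data have variance 1. *)
Definition X_block N (z : 'I_p * 'I_N) (w : T) : R :=
  Num.sqrt n%:R * X_coef psi Y z.2.+1 z.1 w.

Lemma measurable_X_block N (z : 'I_p * 'I_N) : measurable_fun setT (X_block z).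
Proof.
apply: measurable_funM => //.
exact: (measurable_funP (Y (basis_fun psi z.2.+1 z.1))).
Qed.

Lemma sum_X_block_sqr N w : \sum_(z : 'I_p * 'I_N) X_block z w ^+ 2 =
  n%:R * \sum_(j < p) \sum_(1 <= k < N.+1) X_coef psi Y k j w ^+ 2.
Proof.
rewrite (sum_block _ (fun k j => X_coef psi Y k j w ^+ 2)) mulr_sumr.
by apply: eq_bigr => z _; rewrite exprMn sqr_sqrtr.
Qed.

(** The law of the linear combination is part of the model; its mean is linear in
    the coefficients and its variance is read off orthonormality. *)
Lemma mgf_X_block f N : f \in Lfun (cube_leb p) 2%:E ->
  gaussian_mgf (P f) (@X_block N)
    (fun z => Num.sqrt n%:R * \int[cube_leb p]_x (f x * basis_block psi z x)).
Proof.
move=> Lf a.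
have n0 : 0 < n%:R :> R by rewrite ltr0n.
have rn0 : 0 < Num.sqrt n%:R :> R by rewrite sqrtr_gt0.
pose I : finType := ('I_p * 'I_N)%type.
have Lb (z : I) := basis_block_Lfun psi_on z.
have reidx (F : I -> R) : \sum_(i < #|I|) F (enum_val i) = \sum_z F z.
  by rewrite -big_enum_val; apply: eq_bigl.
pose b (z : I) := a z * Num.sqrt n%:R.
have law := @white f Lf #|I| (fun i => b (enum_val i))
   (fun i => basis_block psi (enum_val i)) (fun i => Lb (enum_val i)).
rewrite big_split/= -mulr_suml.
apply: integral_expR_gaussian_law.
- by apply: sumr_ge0 => z _; exact: sqr_ge0.
- apply: measurable_sum => z; apply: measurable_funM => //.
  exact: measurable_X_block.
move=> A mA; move: (law A mA).
under [X in gaussian_law (Rintegral _ _ X)]eq_fun => x do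
  rewrite (reidx (fun z => b z * basis_block psi z x)).
under [X in gaussian_law _ (Rintegral _ _ X / _)]eq_fun => x do
  rewrite (reidx (fun z => b z * basis_block psi z x)).
rewrite (Rintegral_mul_lincomb _ b Lf Lb).
rewrite (Rintegral_sqr_orthonormal b Lb (@basis_block_orthonormal _ _ _ psi_on N)).
have -> : (\sum_i b i ^+ 2) / n%:R = \sum_z a z ^+ 2.
  rewrite mulr_suml; apply: eq_bigr => z _.
  by rewrite exprMn sqr_sqrtr ?(ltW n0)// mulfK// gt_eqF.
have -> : \sum_(i : I) b i * \int[cube_leb p]_x (f x * basis_block psi i x) =
   \sum_z a z * (Num.sqrt n%:R * \int[cube_leb p]_x (f x * basis_block psi z x)).
  by apply: eq_bigr => z _; rewrite /b mulrA.
move=> <-; congr (P f _); apply/seteqP; split => w /=; congr (A _).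
  rewrite (reidx (fun z => b z * Y (basis_block psi z) w)).
  by apply: eq_bigr => z _; rewrite /b /X_block mulrA.
rewrite (reidx (fun z => b z * Y (basis_block psi z) w)).
by apply: eq_bigr => z _; rewrite /b /X_block mulrA.
Qed.
End white_noise.

(** * Rates and the dyadic grid *)

Lemma half_le_ln2 (R : realType) : 1 / 2 <= ln 2 :> R.
Proof.
have h : expR (- (1 / 2)) >= 2^-1 :> R by have := @expR_ge1Dx R (- (1 / 2)); lra.
have := h; rewrite -ler_ln ?posrE ?expR_gt0// expRK lnV ?posrE//; lra.
Qed.

Lemma dyadic_above (R : realType) (y : R) : 1 <= y ->
  y <= (2 ^ absz (Num.ceil (ln y / ln 2)))%:R <= 2 * y.
Proof.
move=> y1; have y0 : 0 < y by lra.
have l20 : 0 < ln 2 :> R by have := @half_le_ln2 R; lra.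
have cy : (0 <= Num.ceil (ln y / ln 2))%R.
  rewrite ceil_ge0; apply: (@lt_le_trans _ _ 0); first by rewrite ltrN10.
  by apply: divr_ge0; [exact: ln_ge0|exact: ltW].
set i := absz _.
have iE : i%:R = (Num.ceil (ln y / ln 2))%:~R :> R by rewrite natr_absz ger0_norm.
have -> : (2 ^ i)%:R = expR (i%:R * ln 2) :> R.
  by rewrite natrX expRM_natl lnK// posrE.
rewrite iE; apply/andP; split.
  by rewrite -[leLHS]lnK ?posrE// ler_expR -ler_pdivrMr//; exact: ceil_ge.
rewrite -[2 * y]lnK ?posrE ?mulr_gt0// ler_expR lnM ?posrE//.
have := ceilB1_lt (ln y / ln 2); rewrite intrB ltr_pdivlMr// mulrBl mul1r.
by move: (_ %:~R * _) => z; clear; lra.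
Qed.

(** The grid stops at the first power of 2 above a number whose logarithm is at
    most 2 (ln (n p) + |ln c|), and ln (n p) is at most e exp L. *)
Definition grid_const (R : realType) (c : R) : R := 2 + 4 * (expR 1 + `|ln c|).

Definition dimension_const (R : realType) (c alpha1 : R) : R :=
  c + 6 * (4 * alpha1 + 1).

Section rates.
Context (R : realType) (c : R).
Hypothesis c_gt0 : 0 < c.

Lemma loglog_ge x : Num.min 1 c <= loglog c x.
Proof.
rewrite /loglog ge_min; case: ltP => [_|->]; first by rewrite lexx orbT.
by [].
Qed.

Lemma loglog_gt0 x : 0 < loglog c x.
Proof. by apply: lt_le_trans (loglog_ge x); rewrite lt_min ltr01. Qed.

(** By definition ln x = exp (ln (ln x)), except where loglog is the constant c;
    there ln x is less than e. *)
Lemma ln_le_expR_loglog x : 1 <= x -> ln x <= expR 1 * expR (loglog c x).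
Proof.
move=> x1; have [lx|lx] := ltP (ln (ln x)) 1; last first.
  have lnx0 : 0 < ln x by apply: contraTT lx; rewrite -leNgt -ltNge => /ln0 ->.
  rewrite /loglog ltNge lx/= lnK ?posrE// -[leLHS]mul1r ler_pM2r//.
  by have := @expR_ge1Dx R 1; lra.
rewrite /loglog lx.
have [lnx0|lnx0] := leP (ln x) 0.
  by apply: (le_trans lnx0); rewrite mulr_ge0 ?expR_ge0.
have : ln x <= expR 1 by rewrite -[leLHS]lnK ?posrE// ler_expR ltW.
move=> h; apply: (le_trans h); rewrite ler_peMr ?expR_ge0//.
by have := @expR_ge1Dx R c; have := c_gt0; lra.
Qed.

Lemma abs_ln_loglog x : - `|ln c| <= ln (loglog c x).
Proof.
rewrite /loglog; case: ltP => [_|h].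
  by have := ler_norm (- ln c); rewrite normrN; lra.
by apply: (@le_trans _ _ 0); [rewrite oppr_le0|exact: ln_ge0].
Qed.

Section np.
Context (p n : nat).
Hypotheses (p_gt0 : (0 < p)%N) (n_gt0 : (0 < n)%N).

Let L := loglog c (n * p)%:R.
Let L0 : 0 < L. Proof. exact: loglog_gt0. Qed.
Let p0 : 0 < p%:R :> R. Proof. by rewrite ltr0n. Qed.
Let n0 : 0 < n%:R :> R. Proof. by rewrite ltr0n. Qed.
Let p1 : 1 <= p%:R :> R. Proof. by rewrite ler1n. Qed.
Let n1 : 1 <= n%:R :> R. Proof. by rewrite ler1n. Qed.
Let s0 : 0 < Num.sqrt (p%:R * L). Proof. by rewrite sqrtr_gt0 mulr_gt0. Qed.

Lemma ln_sqrt (x : R) : 0 < x -> ln (Num.sqrt x) = ln x / 2.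
Proof.
move=> x0; rewrite -[in RHS](sqr_sqrtr (ltW x0)) lnXn ?sqrtr_gt0//.
by rewrite mulr2n; lra.
Qed.

Lemma V_test_exponent_le (alpha0 : R) : 0 < alpha0 ->
  (V_test_exponent c p n alpha0).+1%:R <= grid_const c * expR L.
Proof.
move=> a0; rewrite /V_test_exponent /grid_const -/L.
set B := _ / Num.sqrt _; set e := 2 / _.
have B0 : 0 < B by rewrite divr_gt0// mulr_gt0.
have e0 : 0 <= e by rewrite divr_ge0//; lra.
(* the exponent 2 / (4 alpha0 + 1) is at most 2 whatever alpha0 is *)
have e2 : e <= 2 by rewrite ler_pdivrMr; lra.
have lB : ln B <= ln (n * p)%:R + `|ln c|.
  rewrite /B ln_div ?posrE ?mulr_gt0// natrM lerD2l ln_sqrt ?mulr_gt0//.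
  rewrite lnM ?posrE//.
  have := abs_ln_loglog (n * p)%:R; rewrite -/L.
  by have := ln_ge0 p1; have := normr_ge0 (ln c); lra.
have np1 : 1 <= (n * p)%:R :> R by rewrite ler1n muln_gt0 n_gt0.
have lnp0 := ln_ge0 np1.
have lnp := ln_le_expR_loglog np1; rewrite -/L in lnp.
have c0 := normr_ge0 (ln c).
have l2 := @half_le_ln2 R.
have eL1 : 1 <= expR L by have := @expR_ge1Dx R L; have := L0; lra.
have y4 : ln (B `^ e) / ln 2 <= 4 * (ln (n * p)%:R + `|ln c|).
  rewrite ln_powR ler_pdivrMr; last lra.
  have : e * ln B <= e * (ln (n * p)%:R + `|ln c|) by rewrite ler_wpM2l.
  have : e * (ln (n * p)%:R + `|ln c|) <= 2 * (ln (n * p)%:R + `|ln c|).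
    by rewrite ler_wpM2r// addr_ge0.
  have : 1 / 2 * (ln (n * p)%:R + `|ln c|) <= ln 2 * (ln (n * p)%:R + `|ln c|).
    by rewrite ler_wpM2r// addr_ge0.
  lra.
have fin : 2 + 4 * (ln (n * p)%:R + `|ln c|) <= (2 + 4 * (expR 1 + `|ln c|)) * expR L.
  have : `|ln c| <= `|ln c| * expR L by rewrite ler_peMr.
  lra.
apply: le_trans fin; set y := ln _ / ln 2 in y4 *.
rewrite -natr1; have [cy|cy] := leP 0 (Num.ceil y); last by rewrite /=; lra.
have -> : `|Num.ceil y|%N%:R = (Num.ceil y)%:~R :> R by rewrite natr_absz ger0_norm.
by have := ceilB1_lt y; rewrite intrB; lra.
Qed.

Lemma V_test_dyadic (alpha0 y : R) : 1 <= y ->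
  y <= (n%:R * p%:R / Num.sqrt (p%:R * L)) `^ (2 / (4 * alpha0 + 1)) ->
  exists2 nu, nu \in V_test c p n alpha0 & y <= nu%:R <= 2 * y.
Proof.
move=> y1 yB; have y0 : 0 < y := lt_le_trans ltr01 y1.
exists (2 ^ absz (Num.ceil (ln y / ln 2)))%N; last exact: dyadic_above.
have l20 : 0 < ln 2 :> R by have := @half_le_ln2 R; lra.
have cy : (0 <= Num.ceil (ln y / ln 2))%R.
  rewrite ceil_ge0; apply: (@lt_le_trans _ _ 0); first by rewrite ltrN10.
  by apply: divr_ge0; [exact: ln_ge0|exact: ltW].
apply/mapP; exists (absz (Num.ceil (ln y / ln 2))) => //.
rewrite mem_iota add0n ltnS/= /V_test_exponent -/L.
set z := Num.max 0 _; have z0 : (0 <= z)%R by rewrite le_max lexx.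
rewrite -lez_nat !gez0_abs// /z le_max; apply/orP; right; apply: le_ceil.
rewrite ler_pM2r ?invr_gt0// ler_ln ?posrE//.
exact: lt_le_trans yB.
Qed.

(** Let nu be the power on the right-hand side.  If L = log log (n p) exceeded
    p nu, then ln L would bound ln p and ln nu, and ln nu is at least
    a1 (ln n - ln L / 2) with a1 = 2 / (4 alpha1 + 1), because s >= sqrt p makes
    the base at least n / sqrt L.  Hence a1 exp L = a1 ln (n p) <= 3 L, which
    bounds L in terms of alpha1. *)
Lemma loglog_le_dimension (s alpha alpha1 : R) :
  0 < alpha -> alpha <= alpha1 -> Num.sqrt p%:R <= s ->
  1 <= n%:R * s / Num.sqrt (p%:R * L) ->
  L <= dimension_const c alpha1 *
    (p%:R * (n%:R * s / Num.sqrt (p%:R * L)) `^ (2 / (4 * alpha + 1))).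
Proof.
rewrite /dimension_const => a0 aa1 ps b1.
set b := n%:R * s / Num.sqrt (p%:R * L) in b1 *.
set nu := b `^ _; have b0 : 0 < b by lra.
have e0 : 0 <= 2 / (4 * alpha + 1) by rewrite divr_ge0//; lra.
have lnu : ln nu = 2 / (4 * alpha + 1) * ln b by rewrite /nu ln_powR.
have lb0 : 0 <= ln b by rewrite ln_ge0.
have nu0 : 0 < nu by rewrite powR_gt0.
have lnu0 : 0 <= ln nu by rewrite lnu mulr_ge0.
have nu1 : 1 <= nu by rewrite -ler_ln ?posrE// ln1.
have pnu1 : 1 <= p%:R * nu by rewrite -[leLHS]mul1r; apply: ler_pM.
have c0' := c_gt0; have L0' := L0; have p1' := p1; have n1' := n1.
have p0' := p0; have n0' := n0.
set Bc := c + _.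
have Bc1 : c <= Bc by rewrite /Bc; lra.
have Bc2 : 6 * (4 * alpha1 + 1) <= Bc by rewrite /Bc; lra.
suff : L <= c \/ L <= 6 * (4 * alpha1 + 1) \/ L <= p%:R * nu.
  have Bc0 : 1 <= Bc by rewrite /Bc; lra.
  have h1 : Bc <= Bc * (p%:R * nu) by apply: ler_peMr; lra.
  have h2 : p%:R * nu <= Bc * (p%:R * nu) by apply: ler_peMl; lra.
  by case=> [?|[?|?]]; lra.
rewrite /L /loglog; case: ltP => [_|llx]; first by left.
right; have LE : ln (ln (n * p)%:R) = L by rewrite /L /loglog ltNge llx.
rewrite LE in llx *; have [|pnuL] := leP L (p%:R * nu); [by right|left].
have lnp0 : 0 < ln (n * p)%:R :> R.
  by apply: contraTT llx; rewrite -leNgt -ltNge -LE => /ln0 ->.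
have eL : expR L = ln n%:R + ln p%:R.
  by rewrite -LE lnK ?posrE// natrM lnM ?posrE.
have lp0 := ln_ge0 p1; have ln0' := ln_ge0 n1.
have lLL := ln_sublinear L0.
have lnL : ln p%:R + ln nu <= ln L.
  by rewrite -lnM ?posrE// ler_ln ?posrE ?mulr_gt0// ltW.
have lb : ln n%:R - ln L / 2 <= ln b.
  rewrite /b ln_div ?posrE//; last by rewrite mulr_gt0// (lt_le_trans _ ps)// sqrtr_gt0.
  rewrite lnM ?posrE//; last by rewrite (lt_le_trans _ ps)// sqrtr_gt0.
  rewrite ln_sqrt ?mulr_gt0// lnM ?posrE//.
  have : ln (Num.sqrt p%:R) <= ln s.
    by rewrite ler_ln ?posrE ?sqrtr_gt0// (lt_le_trans _ ps)// sqrtr_gt0.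
  by rewrite ln_sqrt//; lra.
set a1 := 2 / (4 * alpha1 + 1).
have a10 : 0 < a1 by rewrite divr_gt0//; lra.
have a12 : a1 <= 2 by rewrite ler_pdivrMr; lra.
have a1le : a1 <= 2 / (4 * alpha + 1) by rewrite ler_pM2l// lef_pV2 ?posrE; lra.
have h1 : a1 * ln b <= ln nu by rewrite lnu ler_wpM2r.
have h2 : a1 * (ln n%:R - ln L / 2) <= a1 * ln b by rewrite ler_pM2l.
have lL0 : 0 <= ln L by rewrite ln_ge0.
have h3 : a1 * expR L <= 3 * L.
  rewrite eL mulrDr.
  have : a1 * ln p%:R <= 2 * ln p%:R by rewrite ler_wpM2r.
  have : a1 * (ln L / 2) <= 2 * (ln L / 2) by rewrite ler_wpM2r// divr_ge0.
  lra.
have h4 : (1 + L / 2) ^+ 2 <= expR L.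
  rewrite (_ : expR L = expR (L / 2) ^+ 2); last first.
    by rewrite -expRM_natl; congr expR; lra.
  by apply: lerXn2r; rewrite ?nnegrE ?expR_ge0 ?expR_ge1Dx//; lra.
have h5 : a1 * L <= 12.
  rewrite -(ler_pM2r L0); have : a1 * (1 + L / 2) ^+ 2 <= 3 * L.
    by apply: le_trans h3; rewrite ler_pM2l.
  by have := mulr_gt0 a10 L0; nra.
move: h5; rewrite /a1 mulrAC ler_pdivrMr; lra.
Qed.

Lemma tau_dense_sqE (s : nat) (alpha : R) : 0 < alpha ->
  tau_dense_sq c p s n alpha =
  s%:R * ((n%:R * s%:R / Num.sqrt (p%:R * L)) `^ (2 / (4 * alpha + 1)))
    `^ (- (2 * alpha)).
Proof.
move=> a0; rewrite /tau_dense_sq -/L -powRrM; congr (_ * _ `^ _).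
by move: (4 * alpha + 1)^-1 => y; lra.
Qed.

Lemma n_tau_dense_sq (s : nat) (alpha : R) : 0 < alpha -> (0 < s)%N ->
  n%:R * tau_dense_sq c p s n alpha =
  Num.sqrt (p%:R * L *
    (n%:R * s%:R / Num.sqrt (p%:R * L)) `^ (2 / (4 * alpha + 1))).
Proof.
move=> a0 s_gt0; rewrite /tau_dense_sq -/L.
set b := n%:R * s%:R / Num.sqrt (p%:R * L).
have b0 : 0 < b by rewrite divr_gt0// mulr_gt0// ltr0n.
rewrite sqrtrM ?mulr_ge0 ?(ltW p0) ?(ltW L0)//.
rewrite -[Num.sqrt (b `^ _)]powR12_sqrt ?powR_ge0// -powRrM.
rewrite mulrA (_ : n%:R * s%:R = Num.sqrt (p%:R * L) * b); last first.
  by rewrite [RHS]mulrC /b divfK// gt_eqF.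
rewrite -[LHS]mulrA; congr (_ * _).
clearbody b; rewrite -{1}(powRr1 (ltW b0)) -powRD; last by rewrite (gt_eqF b0) implybT.
have : (4 * alpha + 1) * (4 * alpha + 1)^-1 = 1 by rewrite divff//; lra.
move=> h; congr (_ `^ _); move: h; move: (4 * alpha + 1)^-1 => y; lra.
Qed.
End np.
End rates.

(** * Errors of the test *)

(** With this K, exp (- (K - 1) L / 4) is exp (- L) times a factor small enough
    to absorb both grid_const c and 2 / eta, because L >= min(1, c). *)
Definition threshold_const (R : realType) (c eta : R) : R :=
  1 + 4 * (1 + 2 * grid_const c / (eta * Num.min 1 c)).

(** The lower tail bound at this level is 128 * (eta / 256) = eta / 2. *)
Definition tail_level (R : realType) (eta : R) : R := eta / 256.

(** The second term makes the signal large compared with the standard deviation,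
    the third makes it exceed twice the part of the threshold in excess of the
    null mean nu p. *)
Definition separation_const (R : realType) (c eta alpha1 : R) : R :=
  1 + 16 / (tail_level eta * Num.sqrt (Num.min 1 c)) +
  4 * threshold_const c eta * (2 + dimension_const c alpha1).

Lemma threshold_const_gt0 (R : realType) (c eta : R) : 0 < c -> 0 < eta ->
  0 < threshold_const c eta.
Proof.
move=> c0 eta0; have m0 : 0 < Num.min 1 c by rewrite lt_min ltr01.
have M0 : 0 < grid_const c.
  by rewrite /grid_const; have := expR_gt0 (1 : R); have := normr_ge0 (ln c); lra.
have : 0 <= 2 * grid_const c / (eta * Num.min 1 c).
  by apply: divr_ge0; rewrite mulr_ge0// ltW.
by rewrite /threshold_const; lra.
Qed.

Lemma tail_level_bounds (R : realType) (eta : R) : 0 < eta -> eta < 1 ->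
  0 < tail_level eta <= 1 / 256.
Proof. by move=> eta0 eta1; rewrite /tail_level; apply/andP; split; lra. Qed.

Lemma dimension_const_gt0 (R : realType) (c alpha1 : R) : 0 < c -> 0 < alpha1 ->
  0 < dimension_const c alpha1.
Proof. by move=> c0 a1; rewrite /dimension_const; lra. Qed.

Lemma separation_const_gt1 (R : realType) (c eta alpha1 : R) :
  0 < c -> 0 < eta -> eta < 1 -> 0 < alpha1 -> 1 < separation_const c eta alpha1.
Proof.
move=> c0 eta0 eta1 a1; have m0 : 0 < Num.min 1 c by rewrite lt_min ltr01.
have /andP[k0 _] := tail_level_bounds eta0 eta1.
rewrite /separation_const -addrA ltrDl; apply: addr_gt0.
  by apply: divr_gt0 => //; apply: mulr_gt0; rewrite ?sqrtr_gt0.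
apply: mulr_gt0; first by apply: mulr_gt0 => //; exact: threshold_const_gt0.
by apply: addr_gt0 => //; exact: dimension_const_gt0.
Qed.

Lemma bias_absorbed (R : realType) (C E tau2 : R) : 1 < C -> 0 <= tau2 ->
  C ^+ 2 * tau2 <= E + tau2 -> (C - 1) * tau2 <= E.
Proof.
move=> C1 tau0 h; have : C * tau2 <= C ^+ 2 * tau2.
  by rewrite ler_wpM2r// expr2 ler_peMl//; lra.
by lra.
Qed.

Lemma le_sqrt_dimension (R : realType) (B D L : R) : 0 < B -> 0 < D -> 0 < L ->
  L <= B * D -> L <= (1 + B) * Num.sqrt (D * L).
Proof.
move=> B0 D0 L0 LBD.
rewrite -ler_sqr ?nnegrE ?mulr_ge0 ?sqrtr_ge0 ?(ltW L0)//; last by lra.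
rewrite exprMn sqr_sqrtr ?mulr_ge0 ?(ltW D0) ?(ltW L0)//.
apply: (@le_trans _ _ (B * (D * L))); first by rewrite expr2 mulrA ler_pM2r.
by rewrite ler_pM2r ?mulr_gt0//; nra.
Qed.

(** What the separation constant buys.  Here W is n tau^2, S is n times the
    energy in the first nu coefficients, Q = sqrt (d L) and rD = sqrt d with
    d = nu p, and rm is a lower bound for sqrt L. *)
Lemma separation_suffices (R : realType) (k rm K B C W S Q rD L : R) :
  0 < k -> 0 < rm -> 0 < K -> 0 < B ->
  1 + 16 / (k * rm) + 4 * K * (2 + B) < C ->
  (C - 1) * W <= S -> 0 < Q -> Q <= 2 * W -> rm * rD <= Q -> L <= (1 + B) * Q ->
  8 * rD <= k * S /\ K * (Q + L) <= S / 2.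
Proof.
move=> k0 rm0 K0 B0 hC hS Q0 QW rmQ LQ.
have a0 : 0 < 16 / (k * rm) by rewrite divr_gt0// mulr_gt0.
have c0 : 0 < 4 * K * (2 + B) by rewrite !mulr_gt0//; lra.
have CQ : (C - 1) * Q <= 2 * S.
  have : (C - 1) * Q <= (C - 1) * (2 * W) by rewrite ler_pM2l//; lra.
  by lra.
split; last first.
  have : 4 * K * (2 + B) * Q <= (C - 1) * Q by rewrite ler_pM2r//; lra.
  have : K * L <= K * ((1 + B) * Q) by rewrite ler_pM2l.
  by lra.
have h1 : 16 / (k * rm) * Q <= 2 * S.
  by apply: le_trans CQ; rewrite ler_pM2r//; lra.
have h2 : 16 / (k * rm) * (rm * rD) <= 2 * S.
  by apply: le_trans h1; rewrite ler_pM2l.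
have : k * (16 / (k * rm) * (rm * rD)) <= k * (2 * S) by rewrite ler_pM2l.
have : k * k^-1 * (rm^-1 * rm) * rD = rD.
  by rewrite divff ?mulVf ?mul1r// gt_eqF.
by rewrite invfM; move: k^-1 rm^-1 => x y; lra.
Qed.

Section test_errors.
Context (R : realType) (c : R) (p n : nat) (psi : nat -> measurableTypeR R -> R).
Context d (T : measurableType d).
Context (Y : (cube R p -> R) -> {mfun T >-> measurableTypeR R}).
Context (P : (cube R p -> R) -> probability T R).
Hypothesis c_gt0 : 0 < c.
Hypothesis p_gt0 : (0 < p)%N.
Hypothesis n_gt0 : (0 < n)%N.
Hypothesis psi_on : orthonormal_centered psi.
Hypothesis white : gaussian_white_noise n Y P.

Let L := loglog c (n * p)%:R.
Let L0 : 0 < L. Proof. exact: loglog_gt0. Qed.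

Lemma max_phiE K alpha0 w :
  max_phi n psi Y c K alpha0 w =
  has (fun nu => phi n psi Y c K nu w) (V_test c p n alpha0).
Proof.
rewrite /max_phi; elim: (V_test c p n alpha0) => [|nu s IH].
  by rewrite big_nil.
by rewrite big_cons IH /=; case: phi => //=; case: has.
Qed.

Lemma phiE K nu w : phi n psi Y c K nu w =
  (nu%:R * p%:R + K * (Num.sqrt (nu%:R * p%:R * L) + L) <=
   \sum_(z : 'I_p * 'I_nu) X_block n psi Y z w ^+ 2).
Proof. by rewrite /phi sum_X_block_sqr. Qed.

Lemma measurable_phi K nu : measurable [set w | phi n psi Y c K nu w].
Proof.
rewrite (_ : [set w | _] =
  [set w | (nu%:R * p%:R + K * (Num.sqrt (nu%:R * p%:R * L) + L) <=
   \sum_(z : 'I_p * 'I_nu) X_block n psi Y z w ^+ 2)]); last first.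
  by apply/seteqP; split => w /=; rewrite phiE.
rewrite -[X in measurable X]setTI; apply: measurable_fun_le => //.
by apply: measurable_sum_sqr => z; exact: measurable_X_block.
Qed.

Lemma measurable_has_phi K (s : seq nat) :
  measurable [set w | has (fun nu => phi n psi Y c K nu w) s].
Proof.
elim: s => [|nu s IH].
  by rewrite (_ : [set w | _] = set0)//; apply/seteqP; split.
rewrite (_ : [set w | _] = [set w | phi n psi Y c K nu w] `|`
    [set w | has (fun nu => phi n psi Y c K nu w) s]).
  by apply: measurableU => //; exact: measurable_phi.
by apply/seteqP; split => w /=; [move/orP|move=> h; apply/orP].
Qed.

Lemma has_phi_le K (Q : probability T R) (s : seq nat) (q : R) :
  (forall nu, nu \in s -> (Q [set w | phi n psi Y c K nu w] <= q%:E)%E) ->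
  (Q [set w | has (fun nu => phi n psi Y c K nu w) s] <= ((size s)%:R * q)%:E)%E.
Proof.
elim: s => [|nu s IH] Hq.
  by rewrite (_ : [set w | _] = set0) ?measure0 ?mul0r//; apply/seteqP; split.
rewrite (_ : [set w | _] = [set w | phi n psi Y c K nu w] `|`
    [set w | has (fun nu => phi n psi Y c K nu w) s]); last first.
  by apply/seteqP; split => w /=; [move/orP|move=> h; apply/orP].
apply: (le_trans (measureU2 _ _ _)); [exact: measurable_phi|exact: measurable_has_phi|].
rewrite /= -natr1 mulrDl mul1r addrC EFinD.
apply: leeD; last exact: (Hq _ (mem_head _ _)).
by apply: IH => nu' s'; apply: Hq; rewrite in_cons s' orbT.
Qed.

Lemma card_block nu : #|{: 'I_p * 'I_nu}|%:R = nu%:R * p%:R :> R.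
Proof. by rewrite card_prod !card_ord natrM mulrC. Qed.

Lemma card_block_gt0 nu : (0 < nu)%N -> (0 < #|{: 'I_p * 'I_nu}|)%N.
Proof. by move=> nu0; rewrite card_prod !card_ord muln_gt0 p_gt0. Qed.

Lemma V_test_gt0 alpha0 nu : nu \in V_test c p n alpha0 -> (0 < nu)%N.
Proof. by case/mapP => i _ ->; rewrite expn_gt0. Qed.

(** A union bound over the grid. *)
Lemma type_I_error (eta alpha0 : R) : 0 < eta -> 0 < alpha0 ->
  (P (fun=> 0%R)
     [set w | max_phi n psi Y c (threshold_const c eta) alpha0 w = 1%N] <=
   (eta / 2)%:E)%E.
Proof.
move=> eta0 a0; rewrite /threshold_const.
set M := grid_const c; set K := 1 + _.
have m0 : 0 < Num.min 1 c by rewrite lt_min ltr01.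
have M0 : 0 < M.
  rewrite /M /grid_const.
  by have := expR_gt0 (1 : R); have := normr_ge0 (ln c); lra.
have K0 : 0 <= K := ltW (threshold_const_gt0 c_gt0 eta0).
have Lz : (fun=> 0%R : R) \in Lfun (cube_leb p) 2%:E by exact: Lfun_cst.
rewrite (_ : [set w | _] =
    [set w | has (fun nu => phi n psi Y c K nu w) (V_test c p n alpha0)]); last first.
  by apply/seteqP; split => w; rewrite /mkset max_phiE; case: has.
apply: (le_trans (has_phi_le (q := expR (- ((K - 1) * L / 4))) _)).
  move=> nu nuV; have nu0 := V_test_gt0 nuV.
  have := @chi2_upper_tail _ _ _ (P (fun=> 0)) _ _ _
    (@measurable_X_block _ p n psi _ _ Y nu)
    (mgf_X_block n_gt0 psi_on white Lz) K L _ (card_block_gt0 nu0) K0 L0.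
  rewrite card_block; set A := (X in P _ X); set A' := (X in _ -> (P _ X <= _)%E).
  rewrite (_ : A = A'); last by apply/seteqP; split => w; rewrite /A /A' /= phiE.
  apply => z; under eq_Rintegral do rewrite mul0r.
  by rewrite /Rintegral integral0 mulr0.
rewrite lee_fin size_map size_iota.
have Vle := V_test_exponent_le c_gt0 p_gt0 n_gt0 a0; rewrite -/M -/L in Vle.
apply: (le_trans (ler_wpM2r (expR_ge0 _) Vle)).
rewrite -[leLHS]mulrA -expRD.
set x := 2 * M / eta.
have x0 : 0 < x by rewrite divr_gt0// mulr_gt0.
have mL : Num.min 1 c <= L by exact: loglog_ge.
have -> : L + - ((K - 1) * L / 4) = - (x * (L / Num.min 1 c)).
  by rewrite /K /x invfM; move: eta^-1 (Num.min 1 c)^-1 => y z; lra.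
have : expR (- (x * (L / Num.min 1 c))) <= x^-1.
  rewrite expRN lef_pV2 ?posrE ?expR_gt0//.
  have h : x <= x * (L / Num.min 1 c).
    by rewrite ler_peMr ?(ltW x0)// ler_pdivlMr// mul1r.
  by have := expR_ge1Dx (x * (L / Num.min 1 c)); lra.
move=> /(ler_wpM2l (ltW M0)) /le_trans; apply.
rewrite /x le_eqVlt; apply/orP; left; apply/eqP.
rewrite invf_div invfM; have : eta * (M * M^-1) = eta by rewrite divff ?mulr1// gt_eqF.
by move: M^-1 => y; lra.
Qed.

Definition energy f nu : R :=
  \sum_(z : 'I_p * 'I_nu) (\int[cube_leb p]_x (f x * basis_block psi z x)) ^+ 2.

Lemma energy_ge0 f nu : 0 <= energy f nu.
Proof. by apply: sumr_ge0 => z _; exact: sqr_ge0. Qed.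

Lemma signal_norm_le (s nu : nat) (alpha x : R) f :
  signal_space psi s alpha f -> 0 < alpha -> 0 < x -> x <= nu.+1%:R ->
  ('N[cube_leb p]_2%:E[EFin \o f] <=
   (Num.sqrt (energy f nu + s%:R * x `^ (- (2 * alpha))))%:E)%E.
Proof.
move=> [Lf [theta Th Sf]] a0 x0 xnu.
have -> : energy f nu = \sum_(j < p) \sum_(1 <= k < nu.+1) theta k j ^+ 2.
  rewrite (sum_block _ (fun k j => theta k j ^+ 2)); apply: eq_bigr => z _.
  by rewrite (coefE psi_on Lf Sf).
apply: (Lnorm_le_coef psi_on Lf Sf) => N.
exact: coef_space_tail Th a0 x0 xnu.
Qed.

Lemma type_II_error_at (k K : R) f nu : 0 < k -> k <= 1 / 256 -> (0 < nu)%N ->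
  f \in Lfun (cube_leb p) 2%:E ->
  8 * Num.sqrt (nu%:R * p%:R) <= k * (n%:R * energy f nu) ->
  K * (Num.sqrt (nu%:R * p%:R * L) + L) <= n%:R * energy f nu / 2 ->
  (P f [set w | ~~ phi n psi Y c K nu w] <= (128 * k)%:E)%E.
Proof.
move=> k0 k1 nu0 Lf hA hK.
have sumE : \sum_(z : 'I_p * 'I_nu)
    (Num.sqrt n%:R * \int[cube_leb p]_x (f x * basis_block psi z x)) ^+ 2 =
    n%:R * energy f nu.
  by rewrite mulr_sumr; apply: eq_bigr => z _; rewrite exprMn sqr_sqrtr.
have := noncentral_chi2_lower_tail
    (t := nu%:R * p%:R + K * (Num.sqrt (nu%:R * p%:R * L) + L))
    (@measurable_X_block _ p n psi _ _ Y nu)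
    (mgf_X_block n_gt0 psi_on white Lf) k0 k1 (card_block_gt0 nu0).
rewrite card_block sumE => /(_ hA); rewrite lerD2l => /(_ hK).
by congr (P f _ <= _)%E; apply/seteqP; split => w; rewrite /mkset phiE -ltNge.
Qed.

Lemma separation_bounds_energy (C E alpha : R) (s : nat) f : 0 <= C -> 0 <= E ->
  ((C * tau_dense c p s n alpha)%:E <= 'N[cube_leb p]_2%:E[EFin \o f])%E ->
  ('N[cube_leb p]_2%:E[EFin \o f] <= (Num.sqrt E)%:E)%E ->
  C ^+ 2 * tau_dense_sq c p s n alpha <= E.
Proof.
move=> C0 E0 fC /(le_trans fC); rewrite lee_fin => h.
have := h; rewrite -ler_sqr ?nnegrE ?mulr_ge0 ?sqrtr_ge0//.
by rewrite exprMn !sqr_sqrtr// /tau_dense_sq mulr_ge0// powR_ge0.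
Qed.

(** When n s < sqrt (p L), tau^2 exceeds s, which bounds the squared norm of
    every signal of the class: no signal is separated from zero. *)
Lemma no_separated_signal (C alpha : R) (s : nat) f : 0 < alpha -> 1 < C ->
  (0 < s)%N -> n%:R * s%:R / Num.sqrt (p%:R * L) < 1 ->
  signal_space psi s alpha f ->
  ~ ((C * tau_dense c p s n alpha)%:E <= 'N[cube_leb p]_2%:E[EFin \o f])%E.
Proof.
move=> a0 C1 s_gt0 b1 fS fC.
have s0 : 0 < s%:R :> R by rewrite ltr0n.
have b0 : 0 < n%:R * s%:R / Num.sqrt (p%:R * L).
  by rewrite divr_gt0 ?sqrtr_gt0 ?mulr_gt0// ltr0n.
have stau : s%:R <= tau_dense_sq c p s n alpha.
  rewrite /tau_dense_sq -/L ler_peMr ?(ltW s0)//.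
  rewrite -[leLHS](powRr0 (n%:R * s%:R / Num.sqrt (p%:R * L))).
  apply: ger_powR; first by rewrite b0 ltW.
  by rewrite oppr_le0; apply: divr_ge0; lra.
have tau0 : 0 < tau_dense_sq c p s n alpha := lt_le_trans s0 stau.
have : ('N[cube_leb p]_2%:E[EFin \o f] <= (Num.sqrt s%:R)%:E)%E.
  have := signal_norm_le (nu := 0) fS a0 ltr01 (lexx _).
  by rewrite /energy big1 ?add0r ?powR1 ?mulr1// => -[i []].
move=> /(separation_bounds_energy (le_trans ler01 (ltW C1)) (ltW s0) fC).
have : tau_dense_sq c p s n alpha < C ^+ 2 * tau_dense_sq c p s n alpha.
  by rewrite ltr_pMl// exprn_egt1.
move=> h1 h2; have := lt_le_trans h1 (le_trans h2 stau).
by rewrite ltxx.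
Qed.

(** For a separated signal, the level nu of the grid just above
    b ^ (2 / (4 alpha + 1)), where b = n s / sqrt (p L), balances the tail
    s nu^(- 2 alpha) of the signal with the noise level sqrt (nu p L) / n: both
    are of order tau^2, so that most of the energy of the signal is in its first
    nu coefficients and exceeds the threshold of the test at nu. *)
Lemma type_II_error (eta alpha0 alpha1 C alpha : R) (s : nat) f :
  0 < eta -> eta < 1 -> 0 < alpha0 -> alpha0 <= alpha -> alpha <= alpha1 ->
  separation_const c eta alpha1 < C ->
  Num.sqrt p%:R <= s%:R :> R -> (0 < s)%N -> (s <= p)%N ->
  signal_space psi s alpha f ->
  ((C * tau_dense c p s n alpha)%:E <= 'N[cube_leb p]_2%:E[EFin \o f])%E ->
  (P f [set w | max_phi n psi Y c (threshold_const c eta) alpha0 w = 0%N] <=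
   (eta / 2)%:E)%E.
Proof.
move=> eta0 eta1 a0 a0a aa1 sepC ps s_gt0 sp fS fC.
have al0 : 0 < alpha := lt_le_trans a0 a0a.
have al1 : 0 < alpha1 := lt_le_trans al0 aa1.
have Lf : f \in Lfun (cube_leb p) 2%:E by case: fS.
have C1 : 1 < C := lt_trans (separation_const_gt1 c_gt0 eta0 eta1 al1) sepC.
have s0 : 0 < s%:R :> R by rewrite ltr0n.
have p0 : 0 < p%:R :> R by rewrite ltr0n.
have n0 : 0 < n%:R :> R by rewrite ltr0n.
set b := n%:R * s%:R / Num.sqrt (p%:R * L).
have b0 : 0 < b by rewrite divr_gt0 ?sqrtr_gt0 ?mulr_gt0.
have [b1|b1] := ltP b 1.
  by exfalso; exact: no_separated_signal al0 C1 s_gt0 b1 fS fC.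
have q0 : 0 <= 2 / (4 * alpha + 1) by apply: divr_ge0; lra.
have q1 : 0 <= 2 / (4 * alpha0 + 1) by apply: divr_ge0; lra.
have q01 : 2 / (4 * alpha + 1) <= 2 / (4 * alpha0 + 1).
  by rewrite ler_pM2l// lef_pV2 ?posrE; lra.
set y := b `^ (2 / (4 * alpha + 1)).
have y1 : 1 <= y by rewrite -[leLHS](powRr0 b); apply: ler_powR.
have y0 : 0 < y := lt_le_trans ltr01 y1.
have [nu nuV /andP[ynu nuy]] :
    exists2 nu, nu \in V_test c p n alpha0 & y <= nu%:R <= 2 * y.
  apply: V_test_dyadic => //.
  have bB : b <= n%:R * p%:R / Num.sqrt (p%:R * L).
    by rewrite ler_pM2r ?invr_gt0 ?sqrtr_gt0 ?mulr_gt0// ler_pM2l// ler_nat.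
  apply: (@le_trans _ _ (b `^ (2 / (4 * alpha0 + 1)))); first exact: ler_powR.
  by apply: ge0_ler_powR; rewrite ?nnegrE ?(ltW b0)//; exact: le_trans (ltW b0) bB.
have nu_gt0 := V_test_gt0 nuV.
set tau2 := tau_dense_sq c p s n alpha.
have tau2E : tau2 = s%:R * y `^ (- (2 * alpha)) by rewrite /tau2 tau_dense_sqE.
have tau0 : 0 <= tau2 by rewrite tau2E mulr_ge0 ?powR_ge0.
set W := Num.sqrt (p%:R * L * y).
have ntau : n%:R * tau2 = W by rewrite /tau2 n_tau_dense_sq.
have GC : (C - 1) * W <= n%:R * energy f nu.
  have ynu1 : y <= nu.+1%:R by rewrite (le_trans ynu)// ler_nat.
  have := signal_norm_le fS al0 y0 ynu1; rewrite -tau2E.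
  move=> /(separation_bounds_energy (le_trans ler01 (ltW C1)) _ fC).
  rewrite addr_ge0 ?energy_ge0// -/tau2 => /(_ isT) h.
  rewrite -ntau [leLHS]mulrCA ler_pM2l//; exact: bias_absorbed h.
set D : R := nu%:R * p%:R.
have D0 : 0 < D by rewrite mulr_gt0// ltr0n.
set Q := Num.sqrt (D * L).
have Q0 : 0 < Q by rewrite sqrtr_gt0 mulr_gt0.
have QW : Q <= 2 * W.
  rewrite -[2]ger0_norm// -sqrtr_sqr -sqrtrM ?sqr_ge0//; apply: ler_wsqrtr.
  have : p%:R * L * nu%:R <= p%:R * L * (2 * y) by rewrite ler_pM2l// mulr_gt0.
  have : 0 <= p%:R * L * y by rewrite !mulr_ge0// ltW.
  by rewrite /D; lra.
have B0 := dimension_const_gt0 c_gt0 al1.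
have LB : L <= (1 + dimension_const c alpha1) * Q.
  apply: le_sqrt_dimension => //.
  have := @loglog_le_dimension _ _ c_gt0 _ _ p_gt0 n_gt0 s%:R alpha alpha1
    al0 aa1 ps b1.
  move=> /le_trans; apply.
  by rewrite ler_pM2l// /D [_ * p%:R]mulrC ler_pM2l.
have m0 : 0 < Num.min 1 c by rewrite lt_min ltr01.
have QD : Num.sqrt (Num.min 1 c) * Num.sqrt D <= Q.
  rewrite -sqrtrM ?(ltW m0)// /Q [_ * L]mulrC; apply: ler_wsqrtr.
  by rewrite ler_pM2r//; exact: loglog_ge.
have /andP[k0 k1] := tail_level_bounds eta0 eta1.
have rm0 : 0 < Num.sqrt (Num.min 1 c) by rewrite sqrtr_gt0.
have [hD hL] := separation_suffices k0 rm0 (threshold_const_gt0 c_gt0 eta0) B0 sepC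
  GC Q0 QW QD LB.
have -> : eta / 2 = 128 * tail_level eta by rewrite /tail_level; lra.
apply: le_trans (type_II_error_at k0 k1 nu_gt0 Lf hD hL).
apply: le_measure; rewrite ?inE.
- rewrite (_ : [set w | _] = ~` [set w |
    has (fun nu => phi n psi Y c (threshold_const c eta) nu w) (V_test c p n alpha0)]).
    by apply: measurableC; exact: measurable_has_phi.
  by apply/seteqP; split => w; rewrite /mkset max_phiE /setC /mkset; case: has.
- rewrite (_ : [set w | _] = ~` [set w | phi n psi Y c (threshold_const c eta) nu w]).
    by apply: measurableC; exact: measurable_phi.
  by apply/seteqP; split => w; rewrite /setC /mkset => /negP.
- move=> w; rewrite /mkset max_phiE; apply: contra_eqN => ph.
  by rewrite (_ : has _ _ = true)//; apply/hasP; exists nu.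
Qed.
End test_errors.

Theorem theorem4 (R : realType) (c : R) (c_gt0 : 0 < c) (eta : R)
    (eta_gt0 : 0 < eta) (eta_lt1 : eta < 1) :
  exists2 K_eta : R, 0 < K_eta &
  forall alpha1 : R, 0 < alpha1 ->
  exists2 C_eta : R, 0 < C_eta &
  forall (delta alpha0 : R), 0 < delta -> delta < 1 / 2 ->
    0 < alpha0 -> alpha0 < alpha1 ->
  forall (p n : nat), (0 < p)%N -> (0 < n)%N ->
  forall (psi : nat -> measurableTypeR R -> R), orthonormal_centered psi ->
  forall (d : measure_display) (T : measurableType d)
    (Y : (cube R p -> R) -> {mfun T >-> measurableTypeR R})
    (P : (cube R p -> R) -> probability T R),
    gaussian_white_noise n Y P ->
  forall C : R, C_eta < C ->
  (P (fun=> 0%R) [set w | max_phi n psi Y c K_eta alpha0 w = 1%N]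
   + \big[maxe/0]_(1 <= s < p.+1 | (p%:R `^ (1 / 2 + delta) <= s%:R)%R)
       ereal_sup [set ereal_sup
         [set P f [set w | max_phi n psi Y c K_eta alpha0 w = 0%N]
         | f in signal_space psi s alpha `&`
             [set f | (C * tau_dense c p s n alpha)%R%:E
                      <= 'N[cube_leb p]_2%:E[EFin \o f]] ]
       | alpha in `[alpha0, alpha1] ]
   <= eta%:E)%E.
Proof.
exists (threshold_const c eta); first exact: threshold_const_gt0.
move=> alpha1 a1_gt0.
exists (separation_const c eta alpha1).
  exact: lt_trans ltr01 (separation_const_gt1 c_gt0 eta_gt0 eta_lt1 a1_gt0).
move=> delta alpha0 d0 d2 a0 a01 p n p0 n0 psi psi_on d T Y P white C hC.
rewrite [leRHS](_ : _ = (eta / 2)%:E + (eta / 2)%:E)%E; last first.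
  by rewrite -EFinD; congr (_%:E); lra.
apply: leeD; first exact: type_I_error.
rewrite big_nat_cond; apply: bigmax_le => [|s /andP[/andP[s1 sp] ps]].
  by rewrite lee_fin divr_ge0// ltW.
apply: ge_ereal_sup => _ [alpha /= + <-]; rewrite in_itv/= => /andP[a0a aa1].
apply: ge_ereal_sup => _ [f [fS fC] <-].
apply: (type_II_error c_gt0 p0 n0 psi_on white eta_gt0 eta_lt1
  a0 a0a aa1 hC _ s1 sp fS fC).
apply: le_trans ps; rewrite -powR12_sqrt//; apply: ler_powR; first by rewrite ler1n.
by lra.
Qed.
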